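(* There is an algorithm that computes an optimal solution of MinMD$+$OCTC$_{line}$ in $O(n^4 m)$ time, where $n$ is the number of targets and $m$ is the number of base stations.
   Context: MinMD$+$OCTC$_{line}$: targets $\mathcal{T}=\{t_1,\dots,t_n\}$ lie on a line $L$, taken as the $x$-axis, so $t_i=(x(t_i),0)$. Base stations $\mathcal{B}=\{b_1,\dots,b_m\}$ are points of the plane, and $b_k$ has an opening cost $c_k\ge 0$. A fixed radius $r\ge 0$ is given. A solution consists of a set of opened base stations and a finite multiset of mobile sensors; each sensor $s$ is emitted by some opened base station $b_k$ and is placed at a destination point on $L$; its moving distance is the Euclidean distance from $b_k$ to the destination of $s$. A sensor covers a target if the target is at Euclidean distance at most $r$ from the sensor's destination. An opened base station may emit arbitrarily many sensors. A solution is feasible if every target is covered by some sensor; its cost is the sum of the opening costs of opened base stations plus the sum of the moving distances of all sensors. The goal is to find a feasible solution of minimum cost. Running time is measured in the real-RAM model (arithmetic and square roots on reals in unit time). *)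

(* Defs.v *)
From Stdlib Require Import Reals List ZArith.
Open Scope R_scope.

Definition mem := nat -> R.

Definition upd (s : mem) (a : nat) (v : R) : mem :=
  fun k => if Nat.eqb k a then v else s k.

Inductive binop := OAdd | OSub | OMul | ODiv.
Inductive cmp := CLt | CLe | CEq.

Inductive prog : Type :=
| PConst (d : nat) (z : Z)
| PBin (o : binop) (d a b : nat)
| PSqrt (d a : nat)
| PLoad (d a : nat)
| PStore (a src : nat)
| PSkip
| PSeq (p q : prog)
| PIf (c : cmp) (a b : nat) (p q : prog)
| PWhile (c : cmp) (a b : nat) (p : prog).

Definition binop_res (o : binop) (x y v : R) : Prop :=
  match o with
  | OAdd => v = x + y
  | OSub => v = x - y
  | OMul => v = x * y
  | ODiv => y <> 0 /\ v = x / y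
  end.

Definition test (c : cmp) (x y : R) : Prop :=
  match c with CLt => x < y | CLe => x <= y | CEq => x = y end.

(* exec p s s' k : running p from memory s halts in memory s' after k steps.
   (Deterministic; division by 0, sqrt of a negative number and addressing
   with a non-natural number make the machine fail, i.e. there is no run.) *)
Inductive exec : prog -> mem -> mem -> nat -> Prop :=
| EConst d z s : exec (PConst d z) s (upd s d (IZR z)) 1
| EBin o d a b s v : binop_res o (s a) (s b) v -> exec (PBin o d a b) s (upd s d v) 1
| ESqrt d a s : 0 <= s a -> exec (PSqrt d a) s (upd s d (sqrt (s a))) 1
| ELoad d a s k : s a = INR k -> exec (PLoad d a) s (upd s d (s k)) 1
| EStore a src s k : s a = INR k -> exec (PStore a src) s (upd s k (s src)) 1
| ESkip s : exec PSkip s s 0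
| ESeq p q s1 s2 s3 k1 k2 :
    exec p s1 s2 k1 -> exec q s2 s3 k2 -> exec (PSeq p q) s1 s3 (k1 + k2)
| EIfT c a b p q s s' k :
    test c (s a) (s b) -> exec p s s' k -> exec (PIf c a b p q) s s' (S k)
| EIfF c a b p q s s' k :
    ~ test c (s a) (s b) -> exec q s s' k -> exec (PIf c a b p q) s s' (S k)
| EWhileF c a b p s :
    ~ test c (s a) (s b) -> exec (PWhile c a b p) s s 1
| EWhileT c a b p s s1 s2 k1 k2 :
    test c (s a) (s b) -> exec p s s1 k1 -> exec (PWhile c a b p) s1 s2 k2 ->
    exec (PWhile c a b p) s s2 (S (k1 + k2)).

(* targets : list of x-coordinates x(t_1..t_n) (targets are (x,0)).       *)

Definition station := ((R * R) * R)%type.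
Definition st_x (b : station) : R := fst (fst b).
Definition st_y (b : station) : R := snd (fst b).
Definition st_cost (b : station) : R := snd b.

(* A solution: opened flags for b_1..b_m, and a finite multiset (list) of
   sensors, each given by (index k of emitting station, x-coordinate of its
   destination on L). *)
Record solution := mkSol { opened : list bool; sensors : list (nat * R) }.

Definition default_station : station := ((0, 0), 0).

Definition move_dist (B : list station) (sn : nat * R) : R :=
  let b := nth (fst sn) B default_station in
  sqrt ((snd sn - st_x b) ^ 2 + (0 - st_y b) ^ 2).

Fixpoint open_cost (o : list bool) (B : list station) : R :=
  match o, B with
  | f :: o', b :: B' => (if f then st_cost b else 0) + open_cost o' B'
  | _, _ => 0
  end.

Definition sol_cost (B : list station) (S : solution) : R :=
  open_cost (opened S) B
  + fold_right (fun sn acc => move_dist B sn + acc) 0 (sensors S).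

Definition feasible (T : list R) (B : list station) (r : R) (S : solution) : Prop :=
  length (opened S) = length B /\
  (forall sn, In sn (sensors S) ->
      (fst sn < length B)%nat /\ nth (fst sn) (opened S) false = true) /\
  (forall t, In t T -> exists sn, In sn (sensors S) /\
      sqrt ((t - snd sn) ^ 2 + (0 - 0) ^ 2) <= r).

Definition optimal (T : list R) (B : list station) (r : R) (S : solution) : Prop :=
  feasible T B r S /\
  forall S', feasible T B r S' -> sol_cost B S <= sol_cost B S'.

Definition init_mem (T : list R) (B : list station) (r : R) : mem :=
  fun k =>
    let n := length T in
    let m := length B in
    if Nat.eqb k 0 then INR n
    else if Nat.eqb k 1 then INR m
    else if Nat.eqb k 2 then r
    else if Nat.ltb k (3 + n) then nth (k - 3) T 0
    else if Nat.ltb k (3 + n + 3 * m) then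
      let j := (k - 3 - n)%nat in
      let b := nth (j / 3) B default_station in
      match (j mod 3)%nat with
      | O => st_x b
      | 1%nat => st_y b
      | _ => st_cost b
      end
    else 0.

Definition encodes (s : mem) (m : nat) (S : solution) : Prop :=
  length (opened S) = m /\
  (forall k, (k < m)%nat -> s (1 + k)%nat = (if nth k (opened S) false then 1 else 0)) /\
  s 0%nat = INR (length (sensors S)) /\
  (forall j, (j < length (sensors S))%nat ->
      s (1 + m + 2 * j)%nat = INR (fst (nth j (sensors S) (0%nat, 0))) /\
      s (2 + m + 2 * j)%nat = snd (nth j (sensors S) (0%nat, 0))).

(* Main.v *)
Require Import Defs.
From Stdlib Require Import Reals List ZArith.
From Stdlib Require Import Bool Lia Lra FunctionalExtensionality.
Import ListNotations.
Open Scope R_scope.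

(* Two squared distances to points of L differ by an affine function, so if each sensor
   is served by its nearest open station, the sensors of one station are consecutive
   along L.  Hence, for sorted targets, a dynamic program over pairs (number of covered
   targets, last serving station) that pays an opening cost at each change of station is
   exact.  A single sensor of [b_k] covering a given run of targets is best placed at the
   point of an interval closest to [b_k].  This takes O(n^2 m) steps, and the insertion
   sort and the backtracking less.

   The machine program is the compilation of a program in a small language with
   typed arrays and loops bounded by [n] or [m], whose semantics is a total function. *)

(** * Compilation to the real RAM *)

(** Optimality is split in two. Every feasible solution costs at least [F n]: the induction bounds
    not the cost of a prefix alone but [go_on], which demands one more named station to be open, so
    that the opening cost of a station serving several sensors is charged once. Conversely,
    backtracking produces a solution of cost at most [F n]; a station that it opens twice is paid
    for twice in the table but once in reality, so the error is on the safe side.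

    On the machine the obstacle is space. The input fills an initial segment of memory whose end is
    known only at run time, so no cell of fixed address is sure to be free, not even for a loop
    counter. The input is therefore moved beyond an address computed from [n] and [m], the compiled
    program works there with the low cells as registers, and the result is moved back. The cells of
    all arrays are interleaved, so that no array length has to be known in advance.

    The exponent 4 of the bound is slack: loops nest at most twice over [n] and once over [m]. *)

Section Runs.
Local Open Scope bool_scope.
Local Open Scope nat_scope.

(** A total-correctness triple with a time budget: an upper bound [c] instead of the exact step
    count lets costs be composed by syntax alone. *)
Definition runs (p : prog) (s : mem) (Q : mem -> Prop) (c : nat) : Prop :=
  exists s' k, exec p s s' k /\ k <= c /\ Q s'.

Lemma runs_weaken p s (Q Q' : mem -> Prop) c c' :
  runs p s Q c -> (forall s1, Q s1 -> Q' s1) -> c <= c' -> runs p s Q' c'.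
Proof. intros (s1 & k & E & L & H) HQ Hc. exists s1, k. repeat split; auto; lia. Qed.

Lemma runs_seq p q s Q c1 c2 c :
  runs p s (fun s1 => runs q s1 Q c2) c1 -> c1 + c2 <= c -> runs (PSeq p q) s Q c.
Proof.
  intros (s1 & k1 & E1 & L1 & (s2 & k2 & E2 & L2 & H)) Hc.
  exists s2, (k1 + k2). repeat split; auto; [econstructor; eauto | lia].
Qed.

Lemma runs_const d z s (Q : mem -> Prop) : Q (upd s d (IZR z)) -> runs (PConst d z) s Q 1.
Proof. intro H. do 2 eexists; split; [constructor | auto]. Qed.

Lemma runs_add d a b s (Q : mem -> Prop) : Q (upd s d (s a + s b)%R) -> runs (PBin OAdd d a b) s Q 1.
Proof. intro H. do 2 eexists; split; [constructor; reflexivity | auto]. Qed.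

Lemma runs_sub d a b s (Q : mem -> Prop) : Q (upd s d (s a - s b)%R) -> runs (PBin OSub d a b) s Q 1.
Proof. intro H. do 2 eexists; split; [constructor; reflexivity | auto]. Qed.

Lemma runs_mul d a b s (Q : mem -> Prop) : Q (upd s d (s a * s b)%R) -> runs (PBin OMul d a b) s Q 1.
Proof. intro H. do 2 eexists; split; [constructor; reflexivity | auto]. Qed.

Lemma runs_sqrt d a s (Q : mem -> Prop) :
  (0 <= s a)%R -> Q (upd s d (sqrt (s a))) -> runs (PSqrt d a) s Q 1.
Proof. intros H0 H. do 2 eexists; split; [constructor; auto | auto]. Qed.

Lemma runs_load d a k s (Q : mem -> Prop) :
  s a = INR k -> Q (upd s d (s k)) -> runs (PLoad d a) s Q 1.
Proof. intros H0 H. do 2 eexists; split; [econstructor; eauto | auto]. Qed.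

Lemma runs_store a src k s (Q : mem -> Prop) :
  s a = INR k -> Q (upd s k (s src)) -> runs (PStore a src) s Q 1.
Proof. intros H0 H. do 2 eexists; split; [econstructor; eauto | auto]. Qed.

Lemma runs_skip s (Q : mem -> Prop) : Q s -> runs PSkip s Q 0.
Proof. intros H. do 2 eexists; split; [econstructor; eauto | auto]. Qed.

(** Charging both branches makes the time bound a function of the program text, independent of the
    memory. *)
Lemma runs_if c a b p q s Q t1 t2 t :
  (test c (s a) (s b) -> runs p s Q t1) -> (~ test c (s a) (s b) -> runs q s Q t2) ->
  t1 + t2 + 1 <= t -> {test c (s a) (s b)} + {~ test c (s a) (s b)} ->
  runs (PIf c a b p q) s Q t.
Proof.
  intros H1 H2 Ht [y|y].
  - destruct (H1 y) as (s1 & k & E & L & H). exists s1, (S k); repeat split; auto; [constructor; auto|lia].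
  - destruct (H2 y) as (s1 & k & E & L & H). exists s1, (S k); repeat split; auto; [apply EIfF; auto|lia].
Qed.

(** The invariant pins registers [a] and [b] to the counter and the bound, so each test is decided
    by the counter. The leading 1 pays for the last, failing test. *)
Lemma runs_count (I : nat -> mem -> Prop) a b N p s i c (Q : mem -> Prop) :
  i <= N -> I i s ->
  (forall j s1, j <= N -> I j s1 -> s1 a = INR j /\ s1 b = INR N) ->
  (forall j s1, i <= j < N -> I j s1 -> runs p s1 (I (S j)) c) ->
  (forall s1, I N s1 -> Q s1) ->
  runs (PWhile CLt a b p) s Q (1 + (N - i) * (1 + c)).
Proof.
  intros Hi HI Hab Hp HQ.
  remember (N - i) as f eqn:Ef. revert i s Hi HI Hp Ef.
  induction f as [|f IH]; intros i s Hi HI Hp Ef.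
  - assert (i = N) by lia; subst i. exists s, 1. repeat split; auto; try lia.
    destruct (Hab _ _ Hi HI) as [Ea Eb]. apply EWhileF. simpl. rewrite Ea, Eb. lra.
  - destruct (Hp i s) as (s1 & k1 & E1 & L1 & H1); [lia|auto|].
    destruct (IH (S i) s1) as (s2 & k2 & E2 & L2 & H2); [lia|auto| |lia|].
    { intros j s3 Hj. apply Hp; lia. }
    exists s2, (S (k1 + k2)). repeat split; auto; try nia.
    destruct (Hab _ _ Hi HI) as [Ea Eb].
    eapply EWhileT; eauto. simpl. rewrite Ea, Eb. apply lt_INR; lia.
Qed.

Lemma upd_same s a v : upd s a v a = v.
Proof. unfold upd. rewrite Nat.eqb_refl. reflexivity. Qed.

Lemma upd_other s a v k : k <> a -> upd s a v k = s k.
Proof. unfold upd. intros. destruct (Nat.eqb_spec k a); congruence. Qed.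

End Runs.

Ltac mem_simp :=
  repeat match goal with
  | |- context [upd ?s ?a ?v ?a] => rewrite (upd_same s a v)
  | |- context [upd ?s ?a ?v ?k] => rewrite (upd_other s a v k) by lia
  end.

(** * A source language with total semantics *)

Section Language.
Local Open Scope bool_scope.
Local Open Scope nat_scope.

(** Indices live in [nat], apart from the reals, so every address computed by compiled code is the
    image of a natural number and no load or store can fail. For the same reason the square root
    occurs only in [RHyp], where its argument is a sum of squares. *)
Inductive nexp :=
| NC (c : nat) | NN | NM | NIx (l : nat) | NLd (a : nat) (e : nexp)
| NAdd (e f : nexp) | NMul (e f : nexp).

Inductive rexp :=
| RLd (a : nat) (e : nexp) | ROfN (e : nexp)
| RAdd (e f : rexp) | RSub (e f : rexp) | RMin (e f : rexp) | RHyp (e f : rexp).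

Inductive bexp := BNLt (e f : nexp) | BRLt (e f : rexp).

Inductive cmd :=
| CSkip
| CSetN (a : nat) (i v : nexp)
| CSetR (a : nat) (i : nexp) (v : rexp)
| CSeq (p q : cmd)
| CIf (b : bexp) (p q : cmd)
| CForN (p : cmd)
| CForM (p : cmd).

Record heap := mkHeap { na : nat -> nat -> nat; ra : nat -> nat -> R }.

Definition upd2 {X} (f : nat -> nat -> X) (a i : nat) (v : X) : nat -> nat -> X :=
  fun a' i' => if (a' =? a) && (i' =? i) then v else f a' i'.

Definition setN (h : heap) a i v := mkHeap (upd2 (na h) a i v) (ra h).
Definition setR (h : heap) a i v := mkHeap (na h) (upd2 (ra h) a i v).

Definition ext (env : nat -> nat) (l i : nat) : nat -> nat :=
  fun k => if k =? l then i else env k.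

Fixpoint iterate (f : nat -> heap -> heap) (k : nat) (h : heap) : heap :=
  match k with O => h | S k' => f k' (iterate f k' h) end.

Lemma iterate_ind (I : nat -> heap -> Prop) f k h :
  I 0 h -> (forall i h1, i < k -> I i h1 -> I (S i) (f i h1)) -> I k (iterate f k h).
Proof.
  intros H0 HS. induction k as [|k IH]; simpl; auto.
  apply HS; [lia|]. apply IH. intros; apply HS; auto; lia.
Qed.

Variables n m : nat.

Fixpoint evN (env : nat -> nat) (h : heap) (e : nexp) : nat :=
  match e with
  | NC c => c
  | NN => n
  | NM => m
  | NIx l => env l
  | NLd a e => na h a (evN env h e)
  | NAdd e f => evN env h e + evN env h f
  | NMul e f => evN env h e * evN env h f
  end.

Fixpoint evR (env : nat -> nat) (h : heap) (e : rexp) : R :=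
  match e with
  | RLd a e => ra h a (evN env h e)
  | ROfN e => INR (evN env h e)
  | RAdd e f => evR env h e + evR env h f
  | RSub e f => evR env h e - evR env h f
  | RMin e f => Rmin (evR env h e) (evR env h f)
  | RHyp e f => sqrt (evR env h e * evR env h e + evR env h f * evR env h f)
  end%R.

Definition evB (env : nat -> nat) (h : heap) (b : bexp) : bool :=
  match b with
  | BNLt e f => evN env h e <? evN env h f
  | BRLt e f => if Rlt_dec (evR env h e) (evR env h f) then true else false
  end.

(* The argument [d] is the loop nesting depth: the counter of a loop is the
   de Bruijn level at which it occurs, and no command can assign it. *)
Fixpoint den (c : cmd) (d : nat) (env : nat -> nat) (h : heap) : heap :=
  match c with
  | CSkip => h
  | CSetN a i v => setN h a (evN env h i) (evN env h v)
  | CSetR a i v => setR h a (evN env h i) (evR env h v)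
  | CSeq p q => den q d env (den p d env h)
  | CIf b p q => if evB env h b then den p d env h else den q d env h
  | CForN p => iterate (fun i => den p (S d) (ext env d i)) n h
  | CForM p => iterate (fun i => den p (S d) (ext env d i)) m h
  end.

End Language.

(** * The compiler, its time bound and its correctness *)

Section Compile.
Local Open Scope bool_scope.
Local Open Scope nat_scope.

Definition nregs := 40.
Definition narr := 8.
(** This is [2 * narr]: one block of 16 cells holds the [i]-th entry of all eight real and all eight
    natural arrays, so every array is unbounded. *)
Definition stride := 16.

(* Registers: 0 holds the heap base, 1 holds n, 2 holds m, 3 holds 1, 4 + l the counter
   of the loop at level l, and 8, ..., nregs - 1 are temporaries.  Cell i of the real array a
   is at base + stride * i + 2 a, that of the natural array a one cell further. *)
Definition caddr (d off : nat) : prog :=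
  PSeq (PConst (S d) (Z.of_nat stride)) (PSeq (PBin OMul d d (S d))
  (PSeq (PConst (S d) (Z.of_nat off)) (PSeq (PBin OAdd d d (S d)) (PBin OAdd d d 0)))).

Definition cmove (d a : nat) : prog := PSeq (PConst d 0) (PBin OAdd d d a).

Fixpoint cN (e : nexp) (d : nat) : prog :=
  match e with
  | NC c => PConst d (Z.of_nat c)
  | NN => cmove d 1
  | NM => cmove d 2
  | NIx l => cmove d (4 + l)
  | NLd a e => PSeq (cN e d) (PSeq (caddr d (2 * a + 1)) (PLoad d d))
  | NAdd e f => PSeq (cN e d) (PSeq (cN f (S d)) (PBin OAdd d d (S d)))
  | NMul e f => PSeq (cN e d) (PSeq (cN f (S d)) (PBin OMul d d (S d)))
  end.

Fixpoint cR (e : rexp) (d : nat) : prog :=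
  match e with
  | RLd a e => PSeq (cN e d) (PSeq (caddr d (2 * a)) (PLoad d d))
  | ROfN e => cN e d
  | RAdd e f => PSeq (cR e d) (PSeq (cR f (S d)) (PBin OAdd d d (S d)))
  | RSub e f => PSeq (cR e d) (PSeq (cR f (S d)) (PBin OSub d d (S d)))
  | RMin e f => PSeq (cR e d) (PSeq (cR f (S d)) (PIf CLe d (S d) PSkip (cmove d (S d))))
  | RHyp e f => PSeq (cR e d) (PSeq (cR f (S d)) (PSeq (PBin OMul d d d)
      (PSeq (PBin OMul (S d) (S d) (S d)) (PSeq (PBin OAdd d d (S d)) (PSqrt d d)))))
  end.

Definition cB (b : bexp) : prog :=
  match b with
  | BNLt e f => PSeq (cN e 8) (cN f 9)
  | BRLt e f => PSeq (cR e 8) (cR f 9)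
  end.

Definition cfor (d b : nat) (p : prog) : prog :=
  PSeq (PConst (4 + d) 0) (PWhile CLt (4 + d) b (PSeq p (PBin OAdd (4 + d) (4 + d) 3))).

Fixpoint compile (c : cmd) (d : nat) : prog :=
  match c with
  | CSkip => PSkip
  | CSetN a i v => PSeq (cN i 8) (PSeq (caddr 8 (2 * a + 1)) (PSeq (cN v 9) (PStore 8 9)))
  | CSetR a i v => PSeq (cN i 8) (PSeq (caddr 8 (2 * a)) (PSeq (cR v 9) (PStore 8 9)))
  | CSeq p q => PSeq (compile p d) (compile q d)
  | CIf b p q => PSeq (cB b) (PIf CLt 8 9 (compile p d) (compile q d))
  | CForN p => cfor d 1 (compile p (S d))
  | CForM p => cfor d 2 (compile p (S d))
  end.

(** The test on [S d] reserves the scratch register that [caddr d] needs next to [d]; all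
    temporaries thus stay below the heap. *)
Fixpoint wfN (l : nat) (e : nexp) (d : nat) : bool :=
  (S d <? nregs) &&
  match e with
  | NIx k => k <? l
  | NLd a e => (a <? narr) && wfN l e d
  | NAdd e f | NMul e f => wfN l e d && wfN l f (S d)
  | _ => true
  end.

Fixpoint wfR (l : nat) (e : rexp) (d : nat) : bool :=
  (S d <? nregs) &&
  match e with
  | RLd a e => (a <? narr) && wfN l e d
  | ROfN e => wfN l e d
  | RAdd e f | RSub e f | RMin e f | RHyp e f => wfR l e d && wfR l f (S d)
  end.

Definition wfB (l : nat) (b : bexp) : bool :=
  match b with
  | BNLt e f => wfN l e 8 && wfN l f 9
  | BRLt e f => wfR l e 8 && wfR l f 9
  end.

Fixpoint wf (c : cmd) (l : nat) : bool :=
  match c with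
  | CSkip => true
  | CSetN a i v => (a <? narr) && wfN l i 8 && wfN l v 9
  | CSetR a i v => (a <? narr) && wfN l i 8 && wfR l v 9
  | CSeq p q => wf p l && wf q l
  | CIf b p q => wfB l b && wf p l && wf q l
  | CForN p | CForM p => (l <? 4) && wf p (S l)
  end.

Fixpoint tN (e : nexp) : nat :=
  match e with
  | NC _ => 1
  | NN | NM | NIx _ => 2
  | NLd _ e => tN e + 6
  | NAdd e f | NMul e f => tN e + tN f + 1
  end.

Fixpoint tR (e : rexp) : nat :=
  match e with
  | RLd _ e => tN e + 6
  | ROfN e => tN e
  | RAdd e f | RSub e f => tR e + tR f + 1
  | RMin e f | RHyp e f => tR e + tR f + 4
  end.

Definition tB (b : bexp) : nat :=
  match b with
  | BNLt e f => tN e + tN f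
  | BRLt e f => tR e + tR f
  end.

Ltac split_wf :=
  repeat match goal with
  | H : (_ && _)%bool = true |- _ => apply andb_prop in H; destruct H
  | H : (_ <? _) = true |- _ => apply Nat.ltb_lt in H
  end.

Variables n m : nat.

Fixpoint tC (c : cmd) : nat :=
  match c with
  | CSkip => 0
  | CSetN _ i v => tN i + tN v + 6
  | CSetR _ i v => tN i + tR v + 6
  | CSeq p q => tC p + tC q
  | CIf b p q => tB b + tC p + tC q + 1
  | CForN p => 2 + n * (2 + tC p)
  | CForM p => 2 + m * (2 + tC p)
  end.

(** The constant factor of the running time: a loop is counted as if its body ran once, and [fits]
    separately bounds how deeply loops over [n] and over [m] are nested. *)
Fixpoint weight (c : cmd) : nat :=
  match c with
  | CSkip => 0
  | CSetN _ i v => tN i + tN v + 6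
  | CSetR _ i v => tN i + tR v + 6
  | CSeq p q => weight p + weight q
  | CIf b p q => tB b + weight p + weight q + 1
  | CForN p | CForM p => 4 + weight p
  end.

Fixpoint fits (c : cmd) (a b : nat) : bool :=
  match c with
  | CSkip | CSetN _ _ _ | CSetR _ _ _ => true
  | CSeq p q | CIf _ p q => fits p a b && fits q a b
  | CForN p => match a with O => false | S a' => fits p a' b end
  | CForM p => match b with O => false | S b' => fits p a b' end
  end.

Lemma one_le_pow_prod a b : 1 <= (n + 1) ^ a * (m + 1) ^ b.
Proof.
  assert ((n + 1) ^ a <> 0) by (apply Nat.pow_nonzero; lia).
  assert ((m + 1) ^ b <> 0) by (apply Nat.pow_nonzero; lia).
  nia.
Qed.

(** The factors are [n + 1] and [m + 1] because a loop with no round still costs its initialisation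
    and its failing test. *)
Lemma tC_le c : forall a b, fits c a b = true ->
  tC c <= weight c * ((n + 1) ^ a * (m + 1) ^ b).
Proof.
  induction c as [|x i v|x i v|p IHp q IHq|x p IHp q IHq|p IHp|p IHp]; intros a b H;
    cbn [fits] in H; cbn [tC weight]; split_wf; pose proof (one_le_pow_prod a b) as H1.
  - lia.
  - nia.
  - nia.
  - specialize (IHp a b ltac:(assumption)); specialize (IHq a b ltac:(assumption)). nia.
  - specialize (IHp a b ltac:(assumption)); specialize (IHq a b ltac:(assumption)). nia.
  - destruct a as [|a]; [discriminate|]. specialize (IHp a b H).
    rewrite Nat.pow_succ_r'. pose proof (one_le_pow_prod a b) as H2.
    rewrite <- Nat.mul_assoc. nia.
  - destruct b as [|b]; [discriminate|]. specialize (IHp a b H).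
    rewrite Nat.pow_succ_r'. pose proof (one_le_pow_prod a b) as H2.
    rewrite Nat.mul_shuffle3. nia.
Qed.

Variable base : nat.
Hypothesis base_big : nregs <= base.

Definition rep (l : nat) (env : nat -> nat) (h : heap) (s : mem) : Prop :=
  s 0 = INR base /\ s 1 = INR n /\ s 2 = INR m /\ s 3 = 1%R /\
  (forall k, k < l -> s (4 + k) = INR (env k)) /\
  (forall a i, a < narr ->
     s (base + stride * i + 2 * a) = ra h a i /\
     s (base + stride * i + (2 * a + 1)) = INR (na h a i)).

(** The stack discipline of [cN] and [cR]: evaluation at depth [d] may spoil only the temporaries
    from [d] on, so partial results below [d], the loop counters and the heap survive. *)
Definition same_but (d : nat) (s s' : mem) : Prop :=
  forall x, x < d \/ nregs <= x -> s' x = s x.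

Lemma same_but_trans d d' s s1 s2 :
  same_but d s s1 -> same_but d' s1 s2 -> d <= d' -> same_but d s s2.
Proof. intros H1 H2 Hd x Hx. rewrite H2, H1; auto; lia. Qed.

Lemma same_but_upd d s a v : d <= a < nregs -> same_but d s (upd s a v).
Proof. intros Ha x Hx. apply upd_other. lia. Qed.

Lemma rep_same l env h s s' d :
  rep l env h s -> same_but d s s' -> 4 + l <= d -> 4 <= d -> rep l env h s'.
Proof.
  intros (H0 & H1 & H2 & H3 & H4 & H5) Hs Hl Hd.
  repeat split; try (rewrite Hs by lia; auto; fail).
  - intros k Hk. rewrite Hs by lia. auto.
  - rewrite Hs by lia. apply H5; auto.
  - rewrite Hs by lia. apply H5; auto.
Qed.

Lemma runs_caddr d off i s :
  1 <= d -> S d < nregs -> s 0 = INR base -> s d = INR i ->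
  runs (caddr d off) s
    (fun s' => s' d = INR (base + stride * i + off) /\ same_but d s s') 5.
Proof.
  intros Hd Hd2 H0 Hi. unfold caddr.
  eapply runs_seq with (c1 := 1) (c2 := 4); [apply runs_const|lia].
  eapply runs_seq with (c1 := 1) (c2 := 3); [apply runs_mul|lia].
  eapply runs_seq with (c1 := 1) (c2 := 2); [apply runs_const|lia].
  eapply runs_seq with (c1 := 1) (c2 := 1); [apply runs_add|lia].
  apply runs_add. split.
  - mem_simp. rewrite H0, Hi, <- !INR_IZR_INZ, !plus_INR, mult_INR. ring.
  - intros x Hx. mem_simp. reflexivity.
Qed.

Lemma runs_cmove d a s : d <> a -> d < nregs ->
  runs (cmove d a) s (fun s' => s' d = s a /\ same_but d s s') 2.
Proof.
  intros Hd Hn. eapply runs_seq with (c1 := 1) (c2 := 1); [apply runs_const|lia].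
  apply runs_add. split; [mem_simp; ring | intros x Hx; mem_simp; auto].
Qed.

Lemma runs_cN l env h e : forall d s,
  rep l env h s -> wfN l e d = true -> 8 <= d -> l <= 4 ->
  runs (cN e d) s (fun s' => s' d = INR (evN n m env h e) /\ same_but d s s') (tN e).
Proof.
  induction e as [c| | |k|a e IH|e IHe f IHf|e IHe f IHf]; intros d s Hr Hw Hd Hl;
    cbn [wfN wfR wfB wf] in Hw; split_wf; cbn [cN tN evN].
  - apply runs_const. split; [mem_simp; now rewrite <- INR_IZR_INZ | apply same_but_upd; lia].
  - eapply runs_weaken; [apply runs_cmove; lia| |lia]. destruct Hr as (_ & H1 & _).
    cbn beta. rewrite H1. auto.
  - eapply runs_weaken; [apply runs_cmove; lia| |lia]. destruct Hr as (_ & _ & H1 & _).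
    cbn beta. rewrite H1. auto.
  - eapply runs_weaken; [apply runs_cmove; lia| |lia]. destruct Hr as (_ & _ & _ & _ & H1 & _).
    cbn beta. rewrite H1 by auto. auto.
  - eapply runs_seq; [eapply runs_weaken; [apply IH; auto| |apply Nat.le_refl] |].
    intros s1 [E1 S1]. cbn beta.
    eapply runs_seq; [eapply runs_weaken; [apply runs_caddr; eauto; try lia| |apply Nat.le_refl] |].
    + rewrite S1 by lia. apply Hr.
    + intros s2 [E2 S2]. eapply runs_load; [exact E2|]. split.
      * mem_simp. pose proof (same_but_trans _ _ _ _ _ S1 S2 (Nat.le_refl _)) as S3.
        rewrite S3 by lia. apply Hr; auto.
      * eapply (same_but_trans d d); [eapply same_but_trans; eauto|apply same_but_upd|]; lia.
    + apply Nat.le_refl.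
    + lia.
  - eapply runs_seq; [eapply runs_weaken; [apply IHe; auto| |apply Nat.le_refl] |].
    intros s1 [E1 S1]. cbn beta.
    eapply runs_seq; [eapply runs_weaken; [apply (IHf (S d)); auto; try lia| |apply Nat.le_refl] |].
    + eapply rep_same; eauto; lia.
    + intros s2 [E2 S2]. apply runs_add. split.
      * mem_simp. rewrite E2, S2, E1, plus_INR by lia. auto.
      * eapply (same_but_trans d d); [eapply same_but_trans; eauto|apply same_but_upd|]; lia.
    + apply Nat.le_refl.
    + lia.
  - eapply runs_seq; [eapply runs_weaken; [apply IHe; auto| |apply Nat.le_refl] |].
    intros s1 [E1 S1]. cbn beta.
    eapply runs_seq; [eapply runs_weaken; [apply (IHf (S d)); auto; try lia| |apply Nat.le_refl] |].
    + eapply rep_same; eauto; lia.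
    + intros s2 [E2 S2]. apply runs_mul. split.
      * mem_simp. rewrite E2, S2, E1, mult_INR by lia. auto.
      * eapply (same_but_trans d d); [eapply same_but_trans; eauto|apply same_but_upd|]; lia.
    + apply Nat.le_refl.
    + lia.
Qed.

(** The common part of the four binary real operators, which differ only in the code [q] combining
    registers [d] and [S d]. *)
Lemma runs_cR2 l env h e f q v t d s
  (IHe : forall d s, rep l env h s -> wfR l e d = true -> 8 <= d -> l <= 4 ->
     runs (cR e d) s (fun s' => s' d = evR n m env h e /\ same_but d s s') (tR e))
  (IHf : forall d s, rep l env h s -> wfR l f d = true -> 8 <= d -> l <= 4 ->
     runs (cR f d) s (fun s' => s' d = evR n m env h f /\ same_but d s s') (tR f)) :
  rep l env h s -> wfR l e d = true -> wfR l f (S d) = true -> 8 <= d -> l <= 4 ->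
  S d < nregs ->
  (forall s', s' d = evR n m env h e -> s' (S d) = evR n m env h f ->
     runs q s' (fun s2 => s2 d = v /\ same_but d s' s2) t) ->
  runs (PSeq (cR e d) (PSeq (cR f (S d)) q)) s (fun s' => s' d = v /\ same_but d s s')
    (tR e + tR f + t).
Proof.
  intros Hr We Wf Hd Hl Hn Hq.
  eapply runs_seq; [eapply runs_weaken; [apply IHe; auto| |apply Nat.le_refl] |].
  - intros s1 [E1 S1]. cbn beta.
    eapply runs_seq; [eapply runs_weaken; [apply (IHf (S d)); auto; try lia| |apply Nat.le_refl] |].
    + eapply rep_same; eauto; lia.
    + intros s2 [E2 S2]. eapply runs_weaken; [apply Hq; auto| |apply Nat.le_refl].
      * rewrite S2 by lia. auto.
      * intros s3 [E3 S3]. split; auto.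
        eapply same_but_trans; [|exact S3|lia]. eapply same_but_trans; eauto.
    + apply Nat.le_refl.
  - lia.
Qed.

Lemma runs_cR l env h e : forall d s,
  rep l env h s -> wfR l e d = true -> 8 <= d -> l <= 4 ->
  runs (cR e d) s (fun s' => s' d = evR n m env h e /\ same_but d s s') (tR e).
Proof.
  induction e as [a e|e|e IHe f IHf|e IHe f IHf|e IHe f IHf|e IHe f IHf]; intros d s Hr Hw Hd Hl;
    cbn [wfN wfR wfB wf] in Hw; split_wf; cbn [cR tR evR].
  - eapply runs_seq; [eapply runs_weaken; [eapply runs_cN; eauto| |apply Nat.le_refl] |].
    intros s1 [E1 S1]. cbn beta.
    eapply runs_seq; [eapply runs_weaken; [apply runs_caddr; eauto; try lia| |apply Nat.le_refl] |].
    + rewrite S1 by lia. apply Hr.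
    + intros s2 [E2 S2]. eapply runs_load; [exact E2|]. split.
      * mem_simp. pose proof (same_but_trans _ _ _ _ _ S1 S2 (Nat.le_refl _)) as S3.
        rewrite S3 by lia. apply Hr; auto.
      * eapply (same_but_trans d d); [eapply same_but_trans; eauto|apply same_but_upd|]; lia.
    + apply Nat.le_refl.
    + lia.
  - eapply runs_cN; eauto.
  - apply runs_cR2 with (l := l) (env := env) (h := h); auto.
    intros s' E1 E2. apply runs_add. split; [mem_simp; congruence|apply same_but_upd; lia].
  - apply runs_cR2 with (l := l) (env := env) (h := h); auto.
    intros s' E1 E2. apply runs_sub. split; [mem_simp; congruence|apply same_but_upd; lia].
  - apply runs_cR2 with (l := l) (env := env) (h := h); auto.
    intros s' E1 E2.
    apply runs_if with (t1 := 0) (t2 := 2); [intro L|intro L|lia|apply Rle_dec];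
      cbn [test] in L; rewrite E1, E2 in L.
    + apply runs_skip. split; [rewrite Rmin_left; auto|intros x _; auto].
    + eapply runs_weaken; [apply runs_cmove; lia| |lia].
      intros s2 [E3 S3]. split; auto. rewrite E3, E2, Rmin_right; auto. lra.
  - apply runs_cR2 with (l := l) (env := env) (h := h); auto.
    intros s' E1 E2.
    eapply runs_seq with (c1 := 1) (c2 := 3); [apply runs_mul|lia].
    eapply runs_seq with (c1 := 1) (c2 := 2); [apply runs_mul|lia].
    eapply runs_seq with (c1 := 1) (c2 := 1); [apply runs_add|lia].
    apply runs_sqrt.
    + mem_simp. rewrite E1, E2. nra.
    + split; [mem_simp; rewrite E1, E2; auto|intros x Hx; mem_simp; auto].
Qed.

Lemma runs_cB l env h b s :
  rep l env h s -> wfB l b = true -> l <= 4 ->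
  runs (cB b) s (fun s' => (Rlt (s' 8) (s' 9) <-> evB n m env h b = true) /\ same_but 8 s s') (tB b).
Proof.
  intros Hr Hw Hl. destruct b as [e f|e f]; cbn [wfN wfR wfB wf] in Hw; split_wf; cbn [cB tB evB].
  - eapply runs_seq; [eapply runs_weaken; [eapply runs_cN; eauto| |apply Nat.le_refl] |apply Nat.le_refl].
    intros s1 [E1 S1]. cbn beta.
    eapply runs_weaken; [eapply runs_cN; eauto; try lia| |apply Nat.le_refl].
    + eapply rep_same; eauto; lia.
    + intros s2 [E2 S2]. split; [|eapply same_but_trans; eauto].
      rewrite E2, S2, E1 by lia. rewrite Nat.ltb_lt. split; [apply INR_lt|apply lt_INR].
  - eapply runs_seq; [eapply runs_weaken; [eapply runs_cR; eauto| |apply Nat.le_refl] |apply Nat.le_refl].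
    intros s1 [E1 S1]. cbn beta.
    eapply runs_weaken; [eapply runs_cR; eauto; try lia| |apply Nat.le_refl].
    + eapply rep_same; eauto; lia.
    + intros s2 [E2 S2]. split; [|eapply same_but_trans; eauto].
      rewrite E2, S2, E1 by lia. destruct Rlt_dec; split; auto; congruence.
Qed.

(** Addressing is injective because [2 * a + 1 < stride], and [base_big] keeps array cells off the
    registers; one store therefore changes exactly one array entry. *)
Lemma rep_setN l env h s a i v :
  rep l env h s -> l <= 4 -> a < narr ->
  rep l env (setN h a i v) (upd s (base + stride * i + (2 * a + 1)) (INR v)).
Proof.
  intros (H0 & H1 & H2 & H3 & H4 & H5) Hl Ha.
  repeat split; try (rewrite upd_other by (unfold nregs, narr in *; lia); auto).
  - intros k Hk. rewrite upd_other by (unfold nregs, narr in *; lia); auto.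
  - unfold stride, narr in *. rewrite upd_other by lia. apply H5; auto.
  - cbn [na setN]. unfold upd2.
    destruct (Nat.eqb_spec a0 a); [destruct (Nat.eqb_spec i0 i)|]; cbn [andb].
    + subst. apply upd_same.
    + unfold stride, narr in *. rewrite upd_other by lia. apply H5; auto.
    + unfold stride, narr in *. rewrite upd_other by lia. apply H5; auto.
Qed.

Lemma rep_setR l env h s a i v :
  rep l env h s -> l <= 4 -> a < narr ->
  rep l env (setR h a i v) (upd s (base + stride * i + 2 * a) v).
Proof.
  intros (H0 & H1 & H2 & H3 & H4 & H5) Hl Ha.
  repeat split; try (rewrite upd_other by (unfold nregs, narr in *; lia); auto).
  - intros k Hk. rewrite upd_other by (unfold nregs, narr in *; lia); auto.
  - cbn [ra setR]. unfold upd2.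
    destruct (Nat.eqb_spec a0 a); [destruct (Nat.eqb_spec i0 i)|]; cbn [andb].
    + subst. apply upd_same.
    + unfold stride, narr in *. rewrite upd_other by lia. apply H5; auto.
    + unfold stride, narr in *. rewrite upd_other by lia. apply H5; auto.
  - unfold stride, narr in *. rewrite upd_other by lia. apply H5; auto.
Qed.

(** The 2 outside pays for the counter reset and the failing test, the 2 inside for a test and an
    increment per round. On exit [rep l] forgets the counter, so [env] is the old one. *)
Lemma runs_cfor l env h b N p (f : nat -> heap -> heap) t s :
  l < 4 -> rep l env h s ->
  (forall i h1 s1, i < N -> rep (S l) (ext env l i) h1 s1 ->
     runs p s1 (rep (S l) (ext env l i) (f i h1)) t) ->
  (forall i h1 s1, rep (S l) (ext env l i) h1 s1 -> s1 b = INR N) -> b < 4 + l ->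
  runs (cfor l b p) s (rep l env (iterate f N h)) (2 + N * (2 + t)).
Proof.
  intros Hl Hr Hp HN Hb.
  apply runs_seq with (c1 := 1) (c2 := 1 + (N - 0) * (1 + (t + 1))); [apply runs_const|nia].
  apply runs_count with (I := fun i s1 => rep (S l) (ext env l i) (iterate f i h) s1).
  - lia.
  - simpl. destruct Hr as (H0 & H1 & H2 & H3 & H4 & H5). unfold nregs, narr in *.
    repeat split; try (rewrite upd_other by lia; auto).
    + intros k Hk. unfold ext. destruct (Nat.eqb_spec k l).
      * subst. apply upd_same.
      * rewrite upd_other by lia. apply H4. lia.
    + apply H5; auto.
    + apply H5; auto.
  - intros j s1 _ H. split; [|eapply HN; eauto].
    destruct H as (_ & _ & _ & _ & H & _). rewrite H by lia. unfold ext. now rewrite Nat.eqb_refl.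
  - intros j s1 Hj H.
    apply runs_seq with (c1 := t) (c2 := 1); [|lia].
    eapply runs_weaken; [apply Hp; eauto; lia| |lia]. intros s2 H2. apply runs_add.
    change (iterate f (S j) h) with (f j (iterate f j h)).
    destruct H2 as (H0 & H1 & H2 & H3 & H4 & H5). unfold nregs, narr in *.
    repeat split; try (rewrite upd_other by lia; auto).
    + intros k Hk. unfold ext. destruct (Nat.eqb_spec k l).
      * subst. rewrite upd_same, H3, H4 by lia. unfold ext. rewrite Nat.eqb_refl.
        now rewrite S_INR.
      * rewrite upd_other by lia. rewrite H4 by lia. unfold ext.
        destruct (Nat.eqb_spec k l); [lia|auto].
    + apply H5; auto.
    + apply H5; auto.
  - intros s1 (H0 & H1 & H2 & H3 & H4 & H5). repeat split; auto; try apply H5; auto.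
    intros k Hk. rewrite H4 by lia. unfold ext. destruct (Nat.eqb_spec k l); [lia|auto].
Qed.

Theorem runs_compile c : forall l env h s,
  rep l env h s -> wf c l = true -> l <= 4 ->
  runs (compile c l) s (rep l env (den n m c l env h)) (tC c).
Proof.
  induction c as [|a i v|a i v|p IHp q IHq|b p IHp q IHq|p IHp|p IHp];
    intros l env h s Hr Hw Hl; cbn [wfN wfR wfB wf] in Hw; split_wf; cbn [compile tC den].
  - apply runs_skip; auto.
  - eapply runs_seq; [eapply runs_weaken; [eapply runs_cN; eauto| |apply Nat.le_refl] |].
    intros s1 [E1 S1]. cbn beta.
    eapply runs_seq; [eapply runs_weaken; [apply runs_caddr; eauto; unfold nregs; try lia| |apply Nat.le_refl] |].
    + rewrite S1 by lia. apply Hr.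
    + intros s2 [E2 S2]. pose proof (same_but_trans _ _ _ _ _ S1 S2 (Nat.le_refl _)) as S3.
      assert (R2 : rep l env h s2) by (eapply rep_same; eauto; lia).
      eapply runs_seq; [eapply runs_weaken; [eapply runs_cN; eauto; lia| |apply Nat.le_refl] |].
      * intros s3 [E3 S4]. eapply runs_store.
        -- rewrite S4 by lia. exact E2.
        -- rewrite E3. apply rep_setN; auto. eapply rep_same; eauto; lia.
      * apply Nat.le_refl.
    + apply Nat.le_refl.
    + lia.
  - eapply runs_seq; [eapply runs_weaken; [eapply runs_cN; eauto| |apply Nat.le_refl] |].
    intros s1 [E1 S1]. cbn beta.
    eapply runs_seq; [eapply runs_weaken; [apply runs_caddr; eauto; unfold nregs; try lia| |apply Nat.le_refl] |].
    + rewrite S1 by lia. apply Hr.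
    + intros s2 [E2 S2]. pose proof (same_but_trans _ _ _ _ _ S1 S2 (Nat.le_refl _)) as S3.
      assert (R2 : rep l env h s2) by (eapply rep_same; eauto; lia).
      eapply runs_seq; [eapply runs_weaken; [eapply runs_cR; eauto; lia| |apply Nat.le_refl] |].
      * intros s3 [E3 S4]. eapply runs_store.
        -- rewrite S4 by lia. exact E2.
        -- rewrite E3. apply rep_setR; auto. eapply rep_same; eauto; lia.
      * apply Nat.le_refl.
    + apply Nat.le_refl.
    + lia.
  - eapply runs_seq; [|apply Nat.le_refl]. eapply runs_weaken; [apply IHp; eauto| |lia].
    intros s1 H1. apply IHq; auto.
  - eapply runs_seq; [eapply runs_weaken; [eapply runs_cB; eauto| |apply Nat.le_refl] |].
    + intros s1 [E1 S1]. assert (R1 : rep l env h s1) by (eapply rep_same; eauto; lia).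
      apply runs_if with (t1 := tC p) (t2 := tC q);
        [intro L|intro L|apply Nat.le_refl|apply Rlt_dec]; cbn [test] in L; rewrite E1 in L.
      * rewrite L. apply IHp; auto.
      * destruct (evB n m env h b); [congruence|]. apply IHq; auto.
    + lia.
  - apply runs_cfor; auto; try lia.
    intros i h1 s1 R1. apply R1.
  - apply runs_cfor; auto; try lia.
    intros i h1 s1 R1. apply R1.
Qed.

End Compile.

(** * The dynamic program *)

Lemma Rabs_le_bounds x a : Rabs x <= a -> - a <= x <= a.
Proof. unfold Rabs. destruct Rcase_abs; lra. Qed.

(** * Opening costs of sets of stations *)

Section Costs.

Variable c : nat -> R.

Fixpoint csum (o : nat -> bool) (k : nat) : R :=
  match k with O => 0 | S k' => csum o k' + (if o k' then c k' else 0) end.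

Definition with_station (o : nat -> bool) (k : nat) : nat -> bool :=
  fun k' => Nat.eqb k' k || o k'.

Definition without_station (o : nat -> bool) (k : nat) : nat -> bool :=
  fun k' => negb (Nat.eqb k' k) && o k'.

Lemma csum_ext o o' k : (forall i, (i < k)%nat -> o i = o' i) -> csum o k = csum o' k.
Proof.
  induction k as [|k IH]; simpl; intros H; auto. rewrite IH, H; auto.
Qed.

Lemma csum_nonneg o k : (forall i, (i < k)%nat -> 0 <= c i) -> 0 <= csum o k.
Proof.
  induction k as [|k IH]; simpl; intros H; [lra|].
  assert (0 <= csum o k) by (apply IH; auto). assert (0 <= c k) by auto.
  destruct (o k); lra.
Qed.

Lemma csum_without o k a : (a < k)%nat -> o a = true ->
  csum o k = csum (without_station o a) k + c a.
Proof.
  induction k as [|k IH]; intros Ha Ho; [lia|]. simpl.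
  destruct (Nat.eq_dec a k) as [->|Hn].
  - rewrite (csum_ext o (without_station o k) k).
    + unfold without_station at 3. rewrite Nat.eqb_refl, Ho. simpl. lra.
    + intros i Hi. unfold without_station. destruct (Nat.eqb_spec i k); [lia|auto].
  - rewrite IH by (auto; lia). unfold without_station at 3.
    destruct (Nat.eqb_spec k a); [lia|]. simpl. lra.
Qed.

(** Only an inequality, since [a] may be open already; this is what makes repeated opening harmless
    in the backtracking. *)
Lemma csum_with o k a : (forall i, (i < k)%nat -> 0 <= c i) -> (a < k)%nat ->
  csum (with_station o a) k <= csum o k + c a.
Proof.
  intros Hc Ha. rewrite (csum_without (with_station o a) k a); auto.
  2: { unfold with_station. now rewrite Nat.eqb_refl. }
  apply Rplus_le_compat_r.
  destruct (o a) eqn:E.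
  - rewrite (csum_without o k a); auto. specialize (Hc a Ha).
    rewrite (csum_ext _ (without_station o a) k); [lra|].
    intros i _. unfold without_station, with_station. destruct (Nat.eqb i a); auto.
  - right. apply csum_ext. intros i _. unfold without_station, with_station.
    destruct (Nat.eqb_spec i a); subst; auto.
Qed.

End Costs.

Lemma csum_shift c o k :
  csum c o (S k) = (if o 0%nat then c 0%nat else 0) + csum (fun i => c (S i)) (fun i => o (S i)) k.
Proof.
  induction k as [|k IH]; [simpl; lra|].
  change (csum c o (S (S k))) with (csum c o (S k) + (if o (S k) then c (S k) else 0)).
  rewrite IH. simpl. lra.
Qed.

Lemma open_cost_csum B : forall o, length o = length B ->
  open_cost o B =
  csum (fun k => st_cost (nth k B default_station)) (fun k => nth k o false) (length B).
Proof.
  induction B as [|b B IH]; intros [|f o] H; try discriminate; auto.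
  simpl length. rewrite csum_shift. simpl. rewrite IH by auto. reflexivity.
Qed.

(** * Recurrence, placement of sensors and distances *)

Section Tables.

Variables (t : nat -> R) (r : R) (B : list station).
Variables (G : nat -> nat -> R) (F : nat -> R) (P : nat -> nat -> nat) (A : nat -> nat).

Let m := length B.
Definition sx (k : nat) : R := st_x (nth k B default_station).
Definition sy (k : nat) : R := st_y (nth k B default_station).
Definition sc (k : nat) : R := st_cost (nth k B default_station).
Definition sdist (k : nat) (x : R) : R := move_dist B (k, x).

(** The projection of the abscissa of station [k] onto [[t j - r, t i + r]], the set of points
    within [r] of all of [[t i, t j]]. Under [fits_one] this interval is nonempty. *)
Definition dest (k i j : nat) : R := Rmax (t j - r) (Rmin (t i + r) (sx k)).
Definition fits_one (i j : nat) : Prop := t j - t i <= r + r.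

(* In [dp_table], [G j k] is the least cost for the first [j] targets, the last of them
   being served by [k], [F j] the least cost for the first [j] targets, and [go_on i k]
   the least cost for the first [i] targets if [k] is to be open as well. *)
Definition go_on (i k : nat) : R := Rmin (G i k) (F i + sc k).

(** [i] counts the targets left before the last run, so it is also the index of the first target of
    the run [i .. j]. The value is specified twice: attained at [P (S j) k], for the backtracking,
    and below every candidate, for the lower bound. *)
Definition dp_cell (j k : nat) : Prop :=
  (P (S j) k <= j)%nat /\ fits_one (P (S j) k) j /\
  G (S j) k = sdist k (dest k (P (S j) k) j) + go_on (P (S j) k) k /\
  forall i, (i <= j)%nat -> fits_one i j ->
    G (S j) k <= sdist k (dest k i j) + go_on i k.

Definition dp_row (j : nat) : Prop :=
  (forall k, (k < m)%nat -> dp_cell j k) /\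
  (A (S j) < m)%nat /\ F (S j) = G (S j) (A (S j)) /\
  (forall k, (k < m)%nat -> F (S j) <= G (S j) k).

(** Row 0 of [G] already contains the opening cost of [k], so staying in column [k] never charges it
    again. *)
Definition dp_table (J : nat) : Prop :=
  (forall k, (k < m)%nat -> G 0 k = sc k) /\ F 0 = 0 /\
  (forall j, (j < J)%nat -> dp_row j).

Definition psum (L : list (nat * R)) : R :=
  fold_right (fun sn acc => move_dist B sn + acc) 0 L.

Lemma move_dist_nonneg sn : 0 <= move_dist B sn.
Proof. apply sqrt_pos. Qed.

Lemma psum_cons s L : psum (s :: L) = move_dist B s + psum L.
Proof. reflexivity. Qed.

Lemma psum_nil : psum [] = 0.
Proof. reflexivity. Qed.

Lemma psum_nonneg L : 0 <= psum L.
Proof.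
  induction L as [|s L IH]; rewrite ?psum_nil, ?psum_cons; [lra|].
  pose proof (move_dist_nonneg s). lra.
Qed.

Lemma psum_app L L' : psum (L ++ L') = psum L + psum L'.
Proof.
  induction L as [|s L IH]; cbn [app]; rewrite ?psum_nil, ?psum_cons; [lra|].
  rewrite IH. lra.
Qed.

Lemma psum_filter f L : psum (filter f L) <= psum L.
Proof.
  induction L as [|s L IH]; cbn [filter]; rewrite ?psum_nil, ?psum_cons; [lra|].
  pose proof (move_dist_nonneg s). destruct (f s); rewrite ?psum_cons; lra.
Qed.

Lemma psum_filter_drop f p L : In p L -> f p = false ->
  move_dist B p + psum (filter f L) <= psum L.
Proof.
  induction L as [|s L IH]; intros H Hf; [contradiction|]. cbn [filter].
  rewrite psum_cons. destruct H as [->|H].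
  - rewrite Hf. pose proof (psum_filter f L). lra.
  - specialize (IH H Hf). pose proof (move_dist_nonneg s).
    destruct (f s); rewrite ?psum_cons; lra.
Qed.

Definition sqdist (k : nat) (x : R) : R := (x - sx k) ^ 2 + (0 - sy k) ^ 2.

Lemma sqdist_nonneg k x : 0 <= sqdist k x.
Proof. unfold sqdist. apply Rplus_le_le_0_compat; apply pow2_ge_0. Qed.

Lemma dist_le k x k' x' : sdist k x <= sdist k' x' <-> sqdist k x <= sqdist k' x'.
Proof.
  unfold sdist, move_dist. simpl fst. simpl snd. fold (sx k) (sy k) (sx k') (sy k').
  fold (sqdist k x) (sqdist k' x'). split.
  - apply sqrt_le_0; apply sqdist_nonneg.
  - apply sqrt_le_1; apply sqdist_nonneg.
Qed.

Lemma dist_dest_le k i j x : fits_one i j -> t j - r <= x -> x <= t i + r ->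
  sdist k (dest k i j) <= sdist k x.
Proof.
  intros Hf H1 H2. apply dist_le. unfold sqdist. apply Rplus_le_compat_r.
  unfold dest, fits_one in *.
  rewrite <- !Rsqr_pow2. apply Rsqr_le_abs_1.
  unfold Rmax, Rmin, Rabs. repeat destruct Rle_dec; repeat destruct Rcase_abs; lra.
Qed.

Lemma dest_covers k i j x : fits_one i j -> t i <= x <= t j -> Rabs (x - dest k i j) <= r.
Proof.
  unfold fits_one, dest. intros Hf Hx. apply Rabs_le.
  unfold Rmax, Rmin. repeat destruct Rle_dec; lra.
Qed.

(* The difference of two squared distances is affine along L. *)
Lemma closer_on_left k k' x y z :
  sdist k x <= sdist k' x -> sdist k' y < sdist k y -> y <= x -> z < y -> sdist k' z < sdist k z.
Proof.
  intros H1 H2 Hyx Hzy. apply Rnot_le_lt. rewrite dist_le. intro H3.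
  rewrite dist_le in H1. apply Rlt_not_le in H2. rewrite dist_le in H2. apply H2.
  unfold sqdist in *. set (a := sx k) in *. set (a' := sx k') in *.
  set (b := sy k) in *. set (b' := sy k') in *.
  destruct (Req_dec x y) as [->|Hn]; [lra|].
  assert (0 < x - y) by lra.
  destruct (Rle_lt_dec ((y - a) ^ 2 + (0 - b) ^ 2) ((y - a') ^ 2 + (0 - b') ^ 2)) as [|Hl]; [lra|].
  (* [2 * (a' - a)] is the slope of [sqdist k - sqdist k'] along the line. This difference is
     positive at [y]: with slope at most 0 it stays positive at [z < y], and with positive slope it
     would be positive at [x]. *)
  exfalso. destruct (Rle_lt_dec (2 * (a' - a)) 0).
  - assert (2 * (a' - a) * (z - y) >= 0) by nra.
    assert (2 * (a' - a) * (x - y) <= 0) by nra. nra.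
  - assert (2 * (a' - a) * (x - y) > 0) by nra. nra.
Qed.

(** * Lower bound for every feasible solution, and backtracking *)

Variable n : nat.
Hypothesis t_sorted : forall i j, (i <= j < n)%nat -> t i <= t j.
Hypothesis sc_nonneg : forall k, (k < m)%nat -> 0 <= sc k.
Hypothesis table : dp_table n.

Definition nearest (O : nat -> bool) (k : nat) (x : R) : Prop :=
  (k < m)%nat /\ O k = true /\
  forall k', (k' < m)%nat -> O k' = true -> sdist k x <= sdist k' x.

Lemma first_reachable y j : (j < n)%nat -> y <= t j ->
  exists i, (i <= j)%nat /\ y <= t i /\ forall i', (i' < i)%nat -> t i' < y.
Proof.
  induction j as [|j IH]; intros Hj Hy.
  - exists 0%nat. repeat split; auto. lia.
  - destruct (Rle_lt_dec y (t j)) as [H|H].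
    + destruct IH as (i & Hi & H2); auto; [lia|]. exists i. split; auto.
    + exists (S j). repeat split; auto. intros i' Hi.
      apply Rle_lt_trans with (t j); auto. apply t_sorted. lia.
Qed.

Definition left_of (y : R) (s : nat * R) : bool := if Rlt_dec (snd s) y then true else false.

Lemma left_of_spec y s : left_of y s = true <-> snd s < y.
Proof. unfold left_of. destruct Rlt_dec; split; auto; congruence. Qed.

(** Take [i] as the first target not left of [y - r]. The sensor at [y] then covers the run
    [i .. j], and moving it to [dest k i j] does not lengthen its way. Earlier targets lie strictly
    left of [y - r], so whatever covers them stands strictly left of [y]. *)
Lemma last_sensor j L k y : (j < n)%nat -> In (k, y) L -> (k < m)%nat -> Rabs (t j - y) <= r ->
  (forall i, (i < S j)%nat -> exists s, In s L /\ Rabs (t i - snd s) <= r) ->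
  exists i, (i <= j)%nat /\ G (S j) k <= sdist k y + go_on i k /\
    forall i', (i' < i)%nat -> exists s, In s (filter (left_of y) L) /\ Rabs (t i' - snd s) <= r.
Proof.
  intros Hj Hp Hk Hc Hcov. apply Rabs_le_bounds in Hc.
  destruct (first_reachable (y - r) j) as (i & Hi & Hy & Hl); auto; [lra|].
  assert (t i <= t j) by (apply t_sorted; lia).
  exists i. split; [auto|]. split.
  - destruct table as (_ & _ & Hrow). destruct (Hrow j Hj) as (Hcell & _).
    destruct (Hcell k Hk) as (_ & _ & _ & Hmin).
    assert (Hf : fits_one i j) by (unfold fits_one; lra).
    specialize (Hmin i Hi Hf).
    assert (sdist k (dest k i j) <= sdist k y) by (apply dist_dest_le; auto; lra). lra.
  - intros i' Hi'. destruct (Hcov i') as (s & Hs & Ha); [lia|].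
    exists s. split; auto. apply filter_In. split; auto. apply left_of_spec.
    apply Rabs_le_bounds in Ha. specialize (Hl i' Hi'). lra.
Qed.

(* Serving each sensor from its nearest open station, the station [k] nearest to [x]
   either also serves the last sensor [y <= x], or serves none of the sensors left of
   [y], and then its opening cost can be split off. *)
Lemma go_on_lower : forall j L O k x, (j <= n)%nat ->
  nearest O k x ->
  (forall s, In s L -> snd s <= x /\ nearest O (fst s) (snd s)) ->
  (forall i, (i < j)%nat -> exists s, In s L /\ Rabs (t i - snd s) <= r) ->
  go_on j k <= psum L + csum sc O m.
Proof.
  (* [O] must vary in the induction, since the second case below removes [k] from it. *)
  induction j as [j IH] using lt_wf_ind. intros L O k x Hj (Hk & HOk & Hkx) HL Hcov.
  destruct j as [|j].
  { destruct table as (H0 & HF & _). unfold go_on. rewrite H0, HF by auto.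
    eapply Rle_trans; [apply Rmin_l|]. rewrite (csum_without sc O m k) by auto.
    pose proof (psum_nonneg L). pose proof (csum_nonneg sc (without_station O k) m sc_nonneg). lra. }
  destruct (Hcov j) as ([k' y] & Hp & Hcp); [lia|]. simpl in Hcp.
  destruct (HL _ Hp) as [Hyx (Hk' & HOk' & Hn')]. simpl in Hyx, Hk', HOk', Hn'.
  assert (Hdrop : sdist k' y + psum (filter (left_of y) L) <= psum L).
  { apply psum_filter_drop; auto. apply not_true_is_false. rewrite left_of_spec. simpl. lra. }
  (* If [k] is no farther from [y] than [k'], it is also nearest there and can take over this sensor
     without loss. *)
  destruct (Rle_lt_dec (sdist k y) (sdist k' y)) as [Hd|Hd].
  - assert (exists i, (i <= j)%nat /\ G (S j) k <= sdist k y + go_on i k /\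
      forall i', (i' < i)%nat -> exists s, In s (filter (left_of y) L) /\ Rabs (t i' - snd s) <= r)
      as (i & Hi & HG & Hcov').
    (* [L] contains [(k', y)], possibly not [(k, y)], so the latter is added; it disappears again
       under the filter, not being strictly left of [y]. *)
    { destruct (last_sensor j ((k, y) :: L) k y) as (i & Hi & HG & Hc); auto; [left; auto| |].
      - intros i Hi. destruct (Hcov i Hi) as (s & Hs & Ha). exists s. split; [right|]; auto.
      - exists i. split; [auto|]. split; [auto|]. intros i' Hi'.
        destruct (Hc i' Hi') as (s & Hs & Ha). exists s. split; auto.
        simpl in Hs. destruct (left_of y (k, y)) eqn:E; auto.
        apply left_of_spec in E. simpl in E. lra. }
    assert (go_on i k <= psum (filter (left_of y) L) + csum sc O m).
    { apply IH with (x := y); auto; try lia.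
      - repeat split; auto. intros k2 Hk2 HO2. specialize (Hn' k2 Hk2 HO2). lra.
      - intros s Hs. apply filter_In in Hs as [Hs Hl]. apply left_of_spec in Hl.
        split; [lra|]. apply HL; auto. }
    assert (go_on (S j) k <= G (S j) k) by apply Rmin_l. lra.
  (* Here [k'] is strictly closer at [y]. The sensors left of [y] can then do without [k], whose
     opening cost pays for [sc k] in [F (S j) + sc k]. *)
  - destruct (last_sensor j L k' y) as (i & Hi & HG & Hcov'); auto.
    assert (Hkk : k' <> k) by (intros ->; lra).
    assert (Hin : forall k2, without_station O k k2 = true -> O k2 = true)
      by (intros k2; unfold without_station; intros E; apply andb_prop in E; tauto).
    assert (go_on i k' <= psum (filter (left_of y) L) + csum sc (without_station O k) m).
    { apply IH with (x := y); auto; try lia.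
      - split; [auto|]. split; [|auto]. unfold without_station.
        destruct (Nat.eqb_spec k' k); [congruence|auto].
      - intros s Hs. apply filter_In in Hs as [Hs Hl]. apply left_of_spec in Hl.
        split; [lra|]. destruct (HL s Hs) as [_ (Hs1 & Hs2 & Hs3)].
        split; [auto|]. split; [|auto]. unfold without_station.
        destruct (Nat.eqb_spec (fst s) k) as [E|E]; [|auto]. exfalso.
        (* If [k] served [s], then [k'], also open, would be strictly closer to it, against
           nearness. *)
        assert (sdist k' (snd s) < sdist k (snd s)) by (eapply closer_on_left with (x := x) (y := y); auto).
        specialize (Hs3 k' Hk' HOk'). rewrite E in Hs3. lra. }
    rewrite (csum_without sc O m k) by auto.
    destruct table as (_ & _ & Hrow). destruct (Hrow j Hj) as (_ & _ & _ & HF).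
    specialize (HF k' Hk').
    assert (go_on (S j) k <= F (S j) + sc k) by apply Rmin_r. lra.
Qed.

Lemma nearest_exists O x : (exists k, (k < m)%nat /\ O k = true) -> exists k, nearest O k x.
Proof.
  clear sc_nonneg table. unfold nearest. induction m as [|m' IH]; intros (k0 & Hk0 & HO0); [lia|].
  destruct (O m') eqn:Em.
  - destruct (existsb O (seq 0 m')) eqn:Ee.
    + apply existsb_exists in Ee as (k1 & Hk1 & HO1). apply in_seq in Hk1.
      destruct IH as (k & Hk & HOk & Hn); [exists k1; split; auto; lia|].
      destruct (Rle_lt_dec (sdist k x) (sdist m' x)).
      * exists k. repeat split; auto. intros k' Hk' HO'.
        destruct (Nat.eq_dec k' m') as [->|]; auto. apply Hn; auto; lia.
      * exists m'. repeat split; auto. intros k' Hk' HO'.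
        destruct (Nat.eq_dec k' m') as [->|]; [lra|].
        apply Rle_trans with (sdist k x); [lra|]. apply Hn; auto; lia.
    + exists m'. repeat split; auto. intros k' Hk' HO'.
      destruct (Nat.eq_dec k' m') as [->|]; [lra|]. exfalso.
      enough (existsb O (seq 0 m') = true) by congruence.
      apply existsb_exists. exists k'. split; auto. apply in_seq. lia.
  - destruct IH as (k & Hk & HOk & Hn).
    { exists k0. split; auto. destruct (Nat.eq_dec k0 m') as [->|]; [congruence|lia]. }
    exists k. repeat split; auto. intros k' Hk' HO'.
    destruct (Nat.eq_dec k' m') as [->|]; [congruence|]. apply Hn; auto; lia.
Qed.

(** Only the emitting stations change, not the destinations, so coverage is kept. *)
Lemma reassign O L : (forall s, In s L -> (fst s < m)%nat /\ O (fst s) = true) ->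
  exists L', map snd L' = map snd L /\ psum L' <= psum L /\
    forall s, In s L' -> nearest O (fst s) (snd s).
Proof.
  induction L as [|[k y] L IH]; intros H.
  - exists []. repeat split; auto; try lra; contradiction.
  - destruct IH as (L' & H1 & H2 & H3); [intros; apply H; right; auto|].
    destruct (H (k, y)) as [Hk HO]; [left; auto|]. simpl in Hk, HO.
    destruct (nearest_exists O y) as (k1 & Hn); [exists k; auto|].
    exists ((k1, y) :: L'). cbn [map]. rewrite !psum_cons, H1. repeat split.
    + pose proof Hn as (_ & _ & Hd). specialize (Hd k Hk HO). unfold sdist in Hd. lra.
    + destruct H0 as [<-|Hs]; [apply Hn|apply H3; auto].
    + destruct H0 as [<-|Hs]; [apply Hn|apply H3; auto].
    + destruct H0 as [<-|Hs]; [apply Hn|apply H3; auto].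
Qed.

(** The backtracking invariant: targets from [j] on are covered by [L], and the first [j] remain, to
    be continued from station [k]. Since [k] is already counted in [csum], the budget still to be
    spent is [G j k - sc k]. *)
Definition partial (j k : nat) (o : nat -> bool) (L : list (nat * R)) : Prop :=
  (j <= n)%nat /\ (k < m)%nat /\ o k = true /\
  (forall s, In s L -> (fst s < m)%nat /\ o (fst s) = true) /\
  (forall i, (j <= i < n)%nat -> exists s, In s L /\ Rabs (t i - snd s) <= r) /\
  psum L + csum sc o m + (G j k - sc k) <= F n.

Lemma partial_init : (1 <= n)%nat -> partial n (A n) (with_station (fun _ => false) (A n)) [].
Proof.
  intros Hn. assert (exists j, n = S j) as (j & En) by (exists (pred n); lia).
  destruct table as (_ & _ & Hrow). destruct (Hrow j) as (_ & HA & HF & _); [lia|].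
  rewrite <- En in HA, HF.
  repeat split; auto; try contradiction; try lia.
  - unfold with_station. now rewrite Nat.eqb_refl.
  - rewrite psum_nil. pose proof (csum_with sc (fun _ => false) m (A n) sc_nonneg HA).
    assert (csum sc (fun _ => false) m = 0).
    { clear. induction m; simpl; [auto|lra]. }
    lra.
Qed.

(** The two implications correspond to which argument attains the minimum in [go_on]: changing to
    the best station for the remaining prefix, or keeping [k]. *)
Lemma partial_step j k o L : partial (S j) k o L ->
  let i := P (S j) k in
  let L' := L ++ [(k, dest k i j)] in
  (i <= j)%nat /\
  (F i + sc k < G i k -> partial i (A i) (with_station o (A i)) L') /\
  (~ F i + sc k < G i k -> partial i k o L').
Proof.
  intros (Hj & Hk & Ho & Hs & Hc & HF) i L'.
  pose proof table as (HG0 & HF0 & Hrow).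
  destruct (Hrow j) as (Hcell & _); [lia|].
  destruct (Hcell k Hk) as (Hi & Hf & HG & _). fold i in Hi, Hf, HG.
  assert (Hs' : forall s, In s L' -> (fst s < m)%nat /\ o (fst s) = true).
  { intros s H. apply in_app_or in H as [H|[<-|[]]]; auto. }
  assert (Hc' : forall i', (i <= i' < n)%nat -> exists s, In s L' /\ Rabs (t i' - snd s) <= r).
  { intros i' Hi'. destruct (le_lt_dec (S j) i').
    - destruct (Hc i') as (s & H1 & H2); [lia|]. exists s. split; auto. apply in_or_app; auto.
    - exists (k, dest k i j). split; [apply in_or_app; right; left; auto|].
      apply dest_covers; auto. split; apply t_sorted; lia. }
  assert (HL : psum L' = psum L + sdist k (dest k i j)).
  { unfold L'. rewrite psum_app, psum_cons, psum_nil. unfold sdist. lra. }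
  split; [exact Hi|]. split; intros Hlt.
  - assert (go_on i k = F i + sc k) by (apply Rmin_right; lra).
    destruct i as [|i0] eqn:Ei.
    { rewrite HG0, HF0 in Hlt by auto. lra. }
    rewrite <- Ei in *. destruct (Hrow i0) as (_ & HA & HFi & _); [lia|].
    rewrite <- Ei in HA, HFi.
    pose proof (csum_with sc o m (A i) sc_nonneg HA).
    repeat split; auto; try lia.
    + unfold with_station. now rewrite Nat.eqb_refl.
    + apply Hs'; auto.
    + unfold with_station. apply orb_true_intro. right. apply Hs'; auto.
    + lra.
  - assert (go_on i k = G i k) by (apply Rmin_left; lra).
    repeat split; auto; try lia; try (apply Hs'; auto). lra.
Qed.

(** * From tables to optimal solutions *)

Variable T : list R.
Hypothesis T_in_t : forall x, In x T -> exists i, (i < n)%nat /\ t i = x.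
Hypothesis t_in_T : forall i, (i < n)%nat -> In (t i) T.

Lemma sqrt_cover x y : sqrt ((x - y) ^ 2 + (0 - 0) ^ 2) = Rabs (x - y).
Proof. replace ((x - y) ^ 2 + (0 - 0) ^ 2) with (Rsqr (x - y)) by (unfold Rsqr; ring). apply sqrt_Rsqr_abs. Qed.

(** After reassignment, the station [k] whose sensor at [y] covers the last target is nearest to
    [y]. So [go_on_lower] applies, with [x := y], to the targets before the run of that sensor, and
    [F n <= G n k] closes the estimate. *)
Lemma sol_cost_lower S' : feasible T B r S' -> F n <= sol_cost B S'.
Proof.
  intros (Hlen & Hopen & Hcov). unfold sol_cost. rewrite open_cost_csum by auto.
  fold (psum (sensors S')). set (O := fun k => nth k (opened S') false).
  change (fun k => st_cost (nth k B default_station)) with sc. fold m.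
  destruct (reassign O (sensors S') Hopen) as (L & HL1 & HL2 & HL3).
  assert (HcovL : forall i, (i < n)%nat -> exists s, In s L /\ Rabs (t i - snd s) <= r).
  { intros i Hi. destruct (Hcov (t i)) as (s & Hs & Hd); [apply t_in_T; auto|].
    apply in_map with (f := snd) in Hs. rewrite <- HL1 in Hs. apply in_map_iff in Hs as (s1 & E & Hs1).
    exists s1. split; auto. rewrite E. rewrite sqrt_cover in Hd. auto. }
  destruct (Nat.eq_dec n 0) as [En|En].
  { rewrite En. destruct table as (_ & -> & _). pose proof (psum_nonneg (sensors S')).
    pose proof (csum_nonneg sc O m sc_nonneg). lra. }
  assert (exists j, n = S j) as (j & En') by (exists (pred n); lia). clear En. rename En' into En.
  destruct (HcovL j) as ([k y] & Hp & Hc); [lia|]. simpl in Hc.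
  pose proof (HL3 _ Hp) as (Hk & HOk & Hn). simpl in Hk, HOk, Hn.
  destruct (last_sensor j L k y) as (i & Hi & HG & Hcov'); auto; try lia.
  { intros; apply HcovL; lia. }
  assert (go_on i k <= psum (filter (left_of y) L) + csum sc O m).
  { apply go_on_lower with (x := y); auto; try lia.
    - repeat split; auto.
    - intros s Hs. apply filter_In in Hs as [Hs Hl]. apply left_of_spec in Hl.
      split; [lra|auto]. }
  assert (sdist k y + psum (filter (left_of y) L) <= psum L).
  { apply psum_filter_drop; auto. apply not_true_is_false. rewrite left_of_spec. simpl. lra. }
  destruct table as (_ & _ & Hrow). destruct (Hrow j) as (_ & _ & _ & HF); [lia|].
  specialize (HF k Hk). rewrite En. lra.
Qed.

Lemma nth_map_seq o k : (k < m)%nat -> nth k (map o (seq 0 m)) false = o k.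
Proof.
  intros Hk. rewrite nth_indep with (d' := o 0%nat) by (rewrite length_map, length_seq; auto).
  rewrite map_nth. rewrite seq_nth by auto. reflexivity.
Qed.

Lemma optimal_intro o L :
  (forall s, In s L -> (fst s < m)%nat /\ o (fst s) = true) ->
  (forall i, (i < n)%nat -> exists s, In s L /\ Rabs (t i - snd s) <= r) ->
  psum L + csum sc o m <= F n ->
  optimal T B r (mkSol (map o (seq 0 m)) L).
Proof.
  intros Hs Hc HF.
  assert (Hlen : length (map o (seq 0 m)) = length B) by (rewrite length_map, length_seq; auto).
  split.
  - repeat split; auto.
    + apply Hs; auto.
    + simpl. rewrite nth_map_seq; apply Hs; auto.
    + intros x Hx. destruct (T_in_t x Hx) as (i & Hi & <-).
      destruct (Hc i Hi) as (s & H1 & H2). exists s. split; auto. rewrite sqrt_cover. auto.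
  - intros S' HS'. apply sol_cost_lower in HS'. unfold sol_cost at 1. simpl.
    rewrite open_cost_csum by auto. fold (psum L).
    change (fun k => st_cost (nth k B default_station)) with sc. fold m.
    rewrite (csum_ext sc _ o m); [lra|]. intros i Hi. apply nth_map_seq; auto.
Qed.

Lemma partial_optimal k o L : partial 0 k o L -> optimal T B r (mkSol (map o (seq 0 m)) L).
Proof.
  intros (_ & Hk & Ho & Hs & Hc & HF). destruct table as (HG0 & _ & _).
  rewrite HG0 in HF by auto. apply optimal_intro; auto; [intros; apply Hc; lia|lra].
Qed.

End Tables.

Section Frame.

Variables (t : nat -> R) (r : R) (B : list station).
Variables (G G' : nat -> nat -> R) (F F' : nat -> R).
Variables (P P' : nat -> nat -> nat) (A A' : nat -> nat).

Lemma dp_cell_frame j k :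
  (forall i, (i <= S j)%nat -> G' i k = G i k) -> (forall i, (i <= j)%nat -> F' i = F i) ->
  P' (S j) k = P (S j) k -> dp_cell t r B G F P j k -> dp_cell t r B G' F' P' j k.
Proof.
  unfold dp_cell, go_on. intros HG HF HP (H1 & H2 & H3 & H4). rewrite HP.
  repeat split; auto.
  - rewrite !HG, HF by lia. auto.
  - intros i Hi Hf. rewrite !HG, HF by lia. auto.
Qed.

(** The table is filled in place: writing row [S J] or scratch cells must not affect what is known
    about rows up to [J]. *)
Lemma dp_table_frame J :
  (forall i k, (i <= J)%nat -> (k < length B)%nat -> G' i k = G i k) ->
  (forall i k, (i <= J)%nat -> (k < length B)%nat -> P' i k = P i k) ->
  (forall i, (i <= J)%nat -> F' i = F i) -> (forall i, (i <= J)%nat -> A' i = A i) ->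
  dp_table t r B G F P A J -> dp_table t r B G' F' P' A' J.
Proof.
  intros HG HP HF HA (H0 & H1 & H2). split; [|split].
  - intros k Hk. rewrite HG by (auto; lia). auto.
  - rewrite HF by lia. auto.
  - intros j Hj. destruct (H2 j Hj) as (Hc & Ha & Hb & Hd).
    assert (HGA : forall k, (k < length B)%nat -> G' (S j) k = G (S j) k) by (intros; apply HG; lia).
    split; [|split; [|split]].
    + intros k Hk. apply dp_cell_frame; [| | |auto]; intros; [apply HG|apply HF|apply HP]; lia.
    + rewrite HA by lia. auto.
    + rewrite HA, HF, HG by lia. auto.
    + intros k Hk. rewrite HF, HG by lia. auto.
Qed.

End Frame.

(** * The program and its correctness *)

Section Program.
Local Open Scope nat_scope.

(* Real arrays: 0 input (with targets sorted in place), 1 G, 2 F, 3 scratch, 5 output.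
   Natural arrays: 0 P, 1 A (the minimisers); in the backtracking, cell 0 of 2, 3, 4, 5
   holds the number of targets left, the station, the next number of targets left and
   the number of sensors. *)
Definition cell_ix (j k : nexp) : nexp := NAdd (NMul j NM) k.
(** Real array 0 mirrors the initial memory from cell 2 on, whence the offsets: [r] at 2, targets
    from 3, then triples of abscissa, ordinate and cost from [3 + n]. *)
Definition eT (i : nexp) : rexp := RLd 0 (NAdd (NC 3) i).
Definition eX (k : nexp) : rexp := RLd 0 (NAdd (NAdd (NC 3) NN) (NMul (NC 3) k)).
Definition eY (k : nexp) : rexp := RLd 0 (NAdd (NAdd (NC 4) NN) (NMul (NC 3) k)).
Definition eC (k : nexp) : rexp := RLd 0 (NAdd (NAdd (NC 5) NN) (NMul (NC 3) k)).
Definition eR : rexp := RLd 0 (NC 2).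
(** The language has only a minimum; the maximum is the sum minus the minimum. *)
Definition eMax (e f : rexp) : rexp := RSub (RAdd e f) (RMin e f).
(** The last target is passed as an expression, not as an index: in the backtracking it has index
    [vJ - 1], and indices have no subtraction. [emit_prog] reads it at [2 + vJ], which is
    [3 + (vJ - 1)]. *)
Definition eDest (k i : nexp) (tj : rexp) : rexp :=
  eMax (RSub tj eR) (RMin (RAdd (eT i) eR) (eX k)).
Definition eDist (k i : nexp) (tj : rexp) : rexp :=
  RHyp (RSub (eDest k i tj) (eX k)) (RSub (ROfN (NC 0)) (eY k)).
Definition eG (j k : nexp) : rexp := RLd 1 (cell_ix j k).
Definition eOpen (i k : nexp) : rexp := RAdd (RLd 2 i) (eC k).
Definition eVal (j k i : nexp) : rexp :=
  RAdd (eDist k i (eT j)) (RMin (eG i k) (eOpen i k)).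
Definition nS (e : nexp) : nexp := NAdd (NC 1) e.

Definition swap_prog : cmd :=
  CSeq (CSetR 3 (NC 0) (eT (NIx 0)))
  (CSeq (CSetR 0 (NAdd (NC 3) (NIx 0)) (eT (NIx 1)))
        (CSetR 0 (NAdd (NC 3) (NIx 1)) (RLd 3 (NC 0)))).

(** Loops always run over the full range, so the inner bound [j < i] of insertion sort is dropped.
    The exchanges with [j < i] insert entry [i] into the sorted prefix. *)
Definition sort_prog : cmd :=
  CForN (CForN (CIf (BRLt (eT (NIx 0)) (eT (NIx 1))) swap_prog CSkip)).

Definition init_prog : cmd := CForM (CSetR 1 (NIx 0) (eC (NIx 0))).

Definition improve_prog (a : nat) (ix : nexp) (v : rexp) (b : nat) (i : nexp) : cmd :=
  CIf (BRLt v (RLd a ix)) (CSeq (CSetR a ix v) (CSetN b ix i)) CSkip.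

(** The run consisting of target [j] alone is always admissible and serves as the first candidate.
    The guard [i < S j] cuts the full-range loop down to the indices up to [j]. *)
Definition cell_prog : cmd :=
  let ix := cell_ix (nS (NIx 0)) (NIx 1) in
  CSeq (CSeq (CSetR 1 ix (eVal (NIx 0) (NIx 1) (NIx 0))) (CSetN 0 ix (NIx 0)))
  (CForN (CIf (BNLt (NIx 2) (nS (NIx 0)))
    (CIf (BRLt (RAdd eR eR) (RSub (eT (NIx 0)) (eT (NIx 2)))) CSkip
      (improve_prog 1 ix (eVal (NIx 0) (NIx 1) (NIx 2)) 0 (NIx 2)))
    CSkip)).

Definition row_prog : cmd :=
  CSeq (CForM cell_prog)
  (CSeq (CSeq (CSetR 2 (nS (NIx 0)) (eG (nS (NIx 0)) (NC 0))) (CSetN 1 (nS (NIx 0)) (NC 0)))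
  (CForM (improve_prog 2 (nS (NIx 0)) (eG (nS (NIx 0)) (NIx 1)) 1 (NIx 1)))).

Definition vJ := NLd 2 (NC 0).
Definition vK := NLd 3 (NC 0).
Definition vI := NLd 4 (NC 0).
Definition vQ := NLd 5 (NC 0).

Definition switch_prog (ix : nexp) : cmd :=
  CSeq (CSetN 3 (NC 0) (NLd 1 ix)) (CSetR 5 (nS vK) (ROfN (NC 1))).

Definition emit_prog : cmd :=
  CSeq (CSetR 5 (NAdd (NAdd (NC 1) NM) (NMul (NC 2) vQ)) (ROfN vK))
  (CSeq (CSetR 5 (NAdd (NAdd (NC 2) NM) (NMul (NC 2) vQ)) (eDest vK vI (RLd 0 (NAdd (NC 2) vJ))))
        (CSetN 5 (NC 0) (nS vQ))).

(** [vI] buffers the next prefix length because [emit_prog] still needs the old [vJ], which is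
    updated last. *)
Definition trace_step : cmd :=
  CSeq (CSetN 4 (NC 0) (NLd 0 (cell_ix vJ vK)))
  (CSeq emit_prog
  (CSeq (CIf (BRLt (eOpen vI vK) (eG vI vK)) (switch_prog vI) CSkip)
        (CSetN 2 (NC 0) vI))).

(** Each step lowers [vJ], so [n] rounds suffice and the surplus ones are idle. The guard on [n]
    avoids reading [A 0]. *)
Definition trace_prog : cmd :=
  CSeq (CIf (BNLt (NC 0) NN)
    (CSeq (CSetN 2 (NC 0) NN)
    (CSeq (switch_prog NN)
          (CForN (CIf (BNLt (NC 0) vJ) trace_step CSkip)))) CSkip)
  (CSetR 5 (NC 0) (ROfN vQ)).

Definition main_prog : cmd :=
  CSeq sort_prog (CSeq init_prog (CSeq (CForN row_prog) trace_prog)).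

Lemma main_wf : wf main_prog 0 = true.
Proof. vm_compute. reflexivity. Qed.

Lemma main_fits : fits main_prog 4 1 = true.
Proof. reflexivity. Qed.

Lemma upd2_same {X} (f : nat -> nat -> X) a i v : upd2 f a i v a i = v.
Proof. unfold upd2. now rewrite !Nat.eqb_refl. Qed.

Lemma upd2_other {X} (f : nat -> nat -> X) a i v a' i' :
  a' <> a \/ i' <> i -> upd2 f a i v a' i' = f a' i'.
Proof.
  unfold upd2. intros H. destruct (Nat.eqb_spec a' a), (Nat.eqb_spec i' i); simpl; auto. lia.
Qed.

Lemma upd2_array {X} (f : nat -> nat -> X) a i v a' : a' <> a -> upd2 f a i v a' = f a'.
Proof. intros. apply functional_extensionality. intros. apply upd2_other; auto. Qed.

Lemma upd2_twice {X} (f : nat -> nat -> X) a i v w : upd2 (upd2 f a i v) a i w = upd2 f a i w.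
Proof.
  apply functional_extensionality; intros a'. apply functional_extensionality; intros i'.
  unfold upd2. destruct (_ && _); auto.
Qed.

End Program.

Ltac heap_simp :=
  repeat match goal with
  | |- context [upd2 ?f ?a ?i ?v ?a ?i] => rewrite (upd2_same f a i v)
  | |- context [upd2 ?f ?a ?i ?v ?a' ?i'] => rewrite (upd2_other f a i v a' i') by lia
  | |- context [upd2 ?f ?a ?i ?v ?a'] => rewrite (upd2_array f a i v a') by lia
  end.

(** * Sorting the targets *)

Section Sort.
Local Open Scope nat_scope.

Variables (n m : nat) (h0 : heap).

Definition target (h : heap) (i : nat) : R := ra h 0 (3 + i).

(** Feasibility mentions targets only through membership, so the set of values is recorded, without
    multiplicities. *)
Definition rearranged (h : heap) : Prop :=
  (forall x, x < 3 \/ 3 + n <= x -> ra h 0 x = ra h0 0 x) /\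
  (forall a, a <> 0 -> a <> 3 -> ra h a = ra h0 a) /\ na h = na h0 /\
  (forall v, (exists i, i < n /\ target h i = v) <-> (exists i, i < n /\ target h0 i = v)).

Definition sorted_upto (h : heap) (i : nat) : Prop :=
  forall x y, x < y < i -> (target h x <= target h y)%R.

Lemma swap_spec env h i j : env 0 = i -> env 1 = j -> i < n -> j < n -> i <> j ->
  rearranged h ->
  let h' := den n m swap_prog 2 env h in
  rearranged h' /\ target h' i = target h j /\ target h' j = target h i /\
  (forall x, x <> i -> x <> j -> target h' x = target h x).
Proof.
  intros Ei Ej Hi Hj Hij (H1 & H2 & H3 & H4) h'.
  pose proof (eq_refl h') as E. unfold h' at 2 in E.
  cbn [den swap_prog evN evR eT] in E. rewrite Ei, Ej in E. clearbody h'.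
  assert (Ti : target h' i = target h j).
  { unfold target. rewrite E. cbn [ra setR]. heap_simp. auto. }
  assert (Tj : target h' j = target h i).
  { unfold target. rewrite E. cbn [ra setR]. heap_simp. auto. }
  assert (Tx : forall x, x <> i -> x <> j -> target h' x = target h x).
  { intros x Hx Hx'. unfold target. rewrite E. cbn [ra setR]. heap_simp. auto. }
  split; [|auto]. split; [|split; [|split]].
  - intros x Hx. rewrite E. cbn [ra setR]. heap_simp. auto.
  - intros a Ha Ha'. rewrite E. cbn [ra setR]. heap_simp. auto.
  - rewrite E. auto.
  - intros v. rewrite <- H4. split; intros (x & Hx & <-).
    + destruct (Nat.eq_dec x i) as [->|]; [exists j; rewrite Ti; auto|].
      destruct (Nat.eq_dec x j) as [->|]; [exists i; rewrite Tj; auto|].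
      exists x. rewrite Tx; auto.
    + destruct (Nat.eq_dec x i) as [->|]; [exists j; rewrite Tj; auto|].
      destruct (Nat.eq_dec x j) as [->|]; [exists i; rewrite Ti; auto|].
      exists x. rewrite Tx; auto.
Qed.

(* The inner loop also runs past [i], where exchanges only increase the [i]-th entry. *)
Lemma sort_spec env : let h := den n m sort_prog 0 env h0 in
  rearranged h /\ sorted_upto h n.
Proof.
  unfold sort_prog. cbn [den].
  apply iterate_ind with (I := fun i h => rearranged h /\ sorted_upto h i).
  { split; [repeat split; auto|intros x y; lia]. }
  intros i h Hi [HR HS].
  enough (rearranged (iterate (fun i0 => den n m
      (CIf (BRLt (eT (NIx 0)) (eT (NIx 1))) swap_prog CSkip) 2 (ext (ext env 0 i) 1 i0)) n h) /\
    sorted_upto (iterate (fun i0 => den n m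
      (CIf (BRLt (eT (NIx 0)) (eT (NIx 1))) swap_prog CSkip) 2 (ext (ext env 0 i) 1 i0)) n h) i /\
    forall x, x < n -> (target (iterate (fun i0 => den n m
      (CIf (BRLt (eT (NIx 0)) (eT (NIx 1))) swap_prog CSkip) 2 (ext (ext env 0 i) 1 i0)) n h) x
      <= target (iterate (fun i0 => den n m
      (CIf (BRLt (eT (NIx 0)) (eT (NIx 1))) swap_prog CSkip) 2 (ext (ext env 0 i) 1 i0)) n h) i)%R)
    as (H1 & H2 & H3).
  { split; auto. intros x y Hxy. destruct (Nat.eq_dec y i) as [->|]; [apply H3; lia|].
    apply H2; lia. }
  (* Inner invariant: the prefix below [i] stays sorted and entry [i] dominates all entries already
     visited, so after the full pass it dominates everything and extends the prefix. *)
  apply iterate_ind with (I := fun j h => rearranged h /\ sorted_upto h i /\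
    forall x, x < j -> (target h x <= target h i)%R).
  { repeat split; try apply HR; auto. intros; lia. }
  clear h HR HS. intros j h Hj (HR & HS & HM).
  cbn [den evB evR eT evN ext Nat.eqb].
  change (ra h 0 (3 + i)) with (target h i). change (ra h 0 (3 + j)) with (target h j).
  destruct (Rlt_dec (target h i) (target h j)) as [L|L].
  - assert (Hij : i <> j) by (intros ->; lra).
    destruct (swap_spec (ext (ext env 0 i) 1 j) h i j) as (H1 & H2 & H3 & H4); auto.
    cbv zeta in *. set (h' := den n m swap_prog 2 (ext (ext env 0 i) 1 j) h) in *.
    clearbody h'. split; [auto|].
    assert (HM' : forall x, x < S j -> (target h' x <= target h' i)%R).
    { intros x Hx. rewrite H2. destruct (Nat.eq_dec x j) as [->|]; [rewrite H3; lra|].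
      destruct (Nat.eq_dec x i) as [->|]; [rewrite H2; lra|].
      rewrite H4 by auto. specialize (HM x ltac:(lia)). lra. }
    split; [|auto].
    intros x y Hxy.
    destruct (Nat.eq_dec x j) as [Ex|Ex]; [subst x|]; (destruct (Nat.eq_dec y j) as [Ey|Ey]; [subst y|]).
    + lia.
    + rewrite H3, (H4 y) by lia. specialize (HS _ _ Hxy). lra.
    + rewrite H3, (H4 x) by lia. apply HM. lia.
    + rewrite !H4 by lia. apply HS; lia.
  - repeat split; try apply HR; auto. intros x Hx.
    destruct (Nat.eq_dec x j) as [->|]; [lra|]. apply HM; lia.
Qed.

End Sort.

(** * Filling the table in memory *)

Section Dynamic.
Local Open Scope nat_scope.

Variables (n : nat) (r : R) (B : list station) (input : nat -> R).
Let m := length B.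
Hypothesis m_pos : 1 <= m.
Hypothesis r_nonneg : (0 <= r)%R.
Hypothesis input_r : input 2 = r.
Hypothesis input_x : forall k, k < m -> input (3 + n + 3 * k) = sx B k.
Hypothesis input_y : forall k, k < m -> input (4 + n + 3 * k) = sy B k.
Hypothesis input_c : forall k, k < m -> input (5 + n + 3 * k) = sc B k.

Let t (i : nat) : R := input (3 + i).

Definition Gh (h : heap) (j k : nat) : R := ra h 1 (j * length B + k).
Definition Ph (h : heap) (j k : nat) : nat := na h 0 (j * length B + k).
Notation Fh h := (ra h 2).
Notation Ah h := (na h 1).

Lemma evR_dest env h k i tj j :
  ra h 0 = input -> evN n m env h k < m -> evR n m env h tj = t j ->
  evR n m env h (eDest k i tj) = dest t r B (evN n m env h k) (evN n m env h i) j.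
Proof.
  intros HI Hk Hj. unfold eDest, eMax. cbn [evR evN eT eR eX].
  rewrite Hj, HI, input_x, input_r by auto. unfold dest, t.
  generalize (input (3 + j) - r)%R (Rmin (input (3 + evN n m env h i) + r) (sx B (evN n m env h k)))%R.
  intros a b. unfold Rmax, Rmin. destruct Rle_dec; ring.
Qed.

Lemma evR_dist env h k i tj j :
  ra h 0 = input -> evN n m env h k < m -> evR n m env h tj = t j ->
  evR n m env h (eDist k i tj) =
  sdist B (evN n m env h k) (dest t r B (evN n m env h k) (evN n m env h i) j).
Proof.
  intros HI Hk Hj. unfold eDist. cbn [evR evN eX eY].
  rewrite (evR_dest env h k i tj j), HI, input_x, input_y by auto.
  unfold sdist, move_dist. cbn [fst snd INR]. f_equal. unfold sx, sy. ring.
Qed.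

Definition val (h : heap) (j k i : nat) : R :=
  (sdist B k (dest t r B k i j) + go_on B (Gh h) (Fh h) i k)%R.

Lemma evR_val env h j k i :
  ra h 0 = input -> evN n m env h k < m ->
  evR n m env h (eVal j k i) = val h (evN n m env h j) (evN n m env h k) (evN n m env h i).
Proof.
  intros HI Hk. unfold eVal, eG, eOpen. cbn [evR evN eC cell_ix].
  rewrite (evR_dist env h k i (eT j) (evN n m env h j)); auto.
  - rewrite HI, input_c by auto. reflexivity.
  - cbn [evR eT evN]. rewrite HI. reflexivity.
Qed.

Lemma evN_setR env h a x v e : evN n m env (setR h a x v) e = evN n m env h e.
Proof. induction e; cbn [evN]; auto; rewrite ?IHe, ?IHe1, ?IHe2; auto. Qed.

Lemma den_improve a ix v b i d env h :
  den n m (improve_prog a ix v b i) d env h =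
  let x := evN n m env h ix in
  if Rlt_dec (evR n m env h v) (ra h a x)
  then setN (setR h a x (evR n m env h v)) b x (evN n m env h i) else h.
Proof.
  cbn [den improve_prog evB evR]. cbv zeta. rewrite !evN_setR. destruct Rlt_dec; auto.
Qed.

Lemma cell_ne i j k k' : i <= j -> k < m -> k' < m -> i * length B + k' <> S j * length B + k.
Proof. fold m. nia. Qed.

(** A value and its minimiser are always written together. As successive [put]s at one place
    collapse, a whole minimisation loop amounts to a single [put] on its starting heap. *)
Definition put (h : heap) (a b x : nat) (v : R) (p : nat) : heap := setN (setR h a x v) b x p.

Lemma put_put h a b x v p v' p' : put (put h a b x v p) a b x v' p' = put h a b x v' p'.
Proof. unfold put, setN, setR. cbn [na ra]. now rewrite !upd2_twice. Qed.

Lemma val_put h j k i x v p : i <= j -> k < m -> x = S j * length B + k ->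
  val (put h 1 0 x v p) j k i = val h j k i.
Proof.
  intros Hi Hk ->. unfold val, go_on, Gh. cbn [put ra setR setN].
  rewrite upd2_other by (right; apply cell_ne; auto). now rewrite upd2_array by lia.
Qed.

Lemma cell_spec env h j k : j < n -> k < m -> env 0 = j -> env 1 = k -> ra h 0 = input ->
  exists v p, den n m cell_prog 2 env h = put h 1 0 (S j * length B + k) v p /\
    p <= j /\ fits_one t r p j /\ v = val h j k p /\
    forall i, i <= j -> fits_one t r i j -> (v <= val h j k i)%R.
Proof.
  intros Hj Hk E0 E1 HI. unfold cell_prog. cbv zeta.
  set (x := S j * length B + k).
  assert (Hx : forall env' h', env' 0 = j -> env' 1 = k ->
    evN n m env' h' (cell_ix (nS (NIx 0)) (NIx 1)) = x).
  { intros env' h' F0 F1. cbn [evN cell_ix nS]. rewrite F0, F1. reflexivity. }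
  set (I := fun (i : nat) (h' : heap) => exists v p, h' = put h 1 0 x v p /\
    p <= j /\ fits_one t r p j /\ v = val h j k p /\
    forall i', i' < i -> i' <= j -> fits_one t r i' j -> (v <= val h j k i')%R).
  cbn [den]. rewrite evN_setR, !Hx by auto.
  rewrite evR_val by (cbn [evN]; congruence). cbn [evN].  rewrite E0, E1.
  change (setN (setR h 1 x (val h j k j)) 0 x j) with (put h 1 0 x (val h j k j) j).
  match goal with |- context [iterate ?f n ?h1] => enough (HI' : I n (iterate f n h1)) end.
  { destruct HI' as (v & p & H1 & H2 & H3 & H4 & H5). exists v, p.
    repeat split; auto. intros i Hi. apply H5; auto. lia. }
  apply iterate_ind.
  (* The one-target run fits because [r] is nonnegative. *)
  { exists (val h j k j), j. repeat split; auto; [|intros; lia].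
    unfold fits_one. lra. }
  intros i h1 Hi (v & p & -> & Hp & Hf & Hv & Hmin).
  set (h1 := put h 1 0 x v p) in *.
  assert (HI1 : ra h1 0 = input).
  { unfold h1. cbn [put ra setR setN]. now rewrite upd2_array by lia. }
  cbn [den evB evN ext Nat.eqb nS]. rewrite E0.
  destruct (Nat.ltb_spec i (1 + j)).
  2: { exists v, p. repeat split; auto. intros; apply Hmin; auto; lia. }
  cbn [evR eR eT evN ext Nat.eqb]. rewrite HI1, E0, input_r.
  change (input (3 + j)) with (t j). change (input (3 + i)) with (t i).
  destruct Rlt_dec as [L|L].
  { exists v, p. repeat split; auto. intros i' H1 H2 H3.
    destruct (Nat.eq_dec i' i) as [->|]; [unfold fits_one in H3; lra|]. apply Hmin; auto; lia. }
  rewrite den_improve. cbv zeta. rewrite Hx by auto.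
  rewrite evR_val by (auto; cbn [evN ext Nat.eqb]; congruence).
  cbn [evN ext Nat.eqb]. rewrite E0, E1.
  assert (Hval : val h1 j k i = val h j k i) by (apply val_put; auto; lia).
  rewrite Hval.
  replace (ra h1 1 x) with v by (unfold h1; cbn [put ra setR setN]; now rewrite upd2_same).
  destruct Rlt_dec as [L'|L'].
  - exists (val h j k i), i. split.
    { apply put_put. }
    repeat split; auto; [lia|unfold fits_one; lra|].
    intros i' H1 H2 H3. destruct (Nat.eq_dec i' i) as [->|]; [lra|].
    specialize (Hmin i' ltac:(lia) H2 H3). lra.
  - exists v, p. repeat split; auto. intros i' H1 H2 H3.
    destruct (Nat.eq_dec i' i) as [->|]; [lra|]. apply Hmin; auto; lia.
Qed.

(** What the backtracking needs from earlier phases besides the table: the sorted input, and an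
    output array and sensor counter that are still untouched. *)
Definition same_out (h h' : heap) : Prop :=
  ra h' 0 = ra h 0 /\ ra h' 5 = ra h 5 /\ na h' 5 = na h 5.

Lemma same_out_trans h1 h2 h3 : same_out h1 h2 -> same_out h2 h3 -> same_out h1 h3.
Proof. intros (A1 & A2 & A3) (B1 & B2 & B3). repeat split; congruence. Qed.

Lemma same_out_put h a b x v p : a <> 0 -> a <> 5 -> b <> 5 -> same_out h (put h a b x v p).
Proof. intros. repeat split; cbn [put na ra setR setN]; now rewrite upd2_array by lia. Qed.

Notation table h J := (dp_table t r B (Gh h) (Fh h) (Ph h) (Ah h) J).

Lemma cells_spec env h j : j < n -> env 0 = j -> ra h 0 = input -> table h j ->
  let h' := den n m (CForM cell_prog) 1 env h in
  same_out h h' /\ table h' j /\ forall k, k < m -> dp_cell t r B (Gh h') (Fh h') (Ph h') j k.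
Proof.
  intros Hj E0 HI HT. cbv zeta. cbn [den].
  apply iterate_ind with (I := fun k h' => same_out h h' /\ table h' j /\
    forall k', k' < k -> dp_cell t r B (Gh h') (Fh h') (Ph h') j k').
  { split; [repeat split|]. split; [exact HT|]. intros; lia. }
  clear HT. intros k h1 Hk (HS & HT & HC).
  destruct (cell_spec (ext env 1 k) h1 j k) as (v & p & E & Hp & Hf & Hv & Hmin); auto.
  { destruct HS as (HS0 & _). rewrite HS0. exact HI. }
  cbn [den] in E. rewrite E. clear E. set (x := S j * length B + k) in *.
  assert (HG : forall i k', i <= j -> k' < m -> Gh (put h1 1 0 x v p) i k' = Gh h1 i k').
  { intros. unfold Gh. cbn [put na ra setR setN]. apply upd2_other. right. apply cell_ne; auto. }
  assert (HP : forall i k', i <= j -> k' < m -> Ph (put h1 1 0 x v p) i k' = Ph h1 i k').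
  { intros. unfold Ph. cbn [put na ra setR setN]. apply upd2_other. right. apply cell_ne; auto. }
  assert (HF : Fh (put h1 1 0 x v p) = Fh h1).
  { cbn [put na ra setR setN]. now rewrite upd2_array by lia. }
  assert (HA : Ah (put h1 1 0 x v p) = Ah h1).
  { cbn [put na ra setR setN]. now rewrite upd2_array by lia. }
  split; [|split].
  - eapply same_out_trans; [exact HS|apply same_out_put; lia].
  - rewrite HF, HA. eapply dp_table_frame; [exact HG|exact HP| | |exact HT]; auto.
  - intros k' Hk'. rewrite HF. destruct (Nat.eq_dec k' k) as [->|Hn].
    + unfold dp_cell.
      replace (Ph (put h1 1 0 x v p) (S j) k) with p
        by (unfold Ph; cbn [put na ra setR setN]; fold x; now rewrite upd2_same).
      replace (Gh (put h1 1 0 x v p) (S j) k) with v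
        by (unfold Gh; cbn [put na ra setR setN]; fold x; now rewrite upd2_same).
      split; [auto|]. split; [auto|]. unfold go_on. split.
      * rewrite HG by auto. exact Hv.
      * intros i Hi Hfi. rewrite HG by auto. apply Hmin; auto.
    + apply dp_cell_frame with (G := Gh h1) (F := Fh h1) (P := Ph h1); auto.
      * intros i Hi. destruct (Nat.eq_dec i (S j)) as [->|]; [|apply HG; lia].
        unfold Gh. cbn [put na ra setR setN]. apply upd2_other. right. unfold x. lia.
      * unfold Ph. cbn [put na ra setR setN]. apply upd2_other. right. unfold x. lia.
      * apply HC. lia.
Qed.

Lemma row_spec env h j : j < n -> env 0 = j -> ra h 0 = input -> table h j ->
  let h' := den n m row_prog 1 env h in same_out h h' /\ table h' (S j).
Proof.
  intros Hj E0 HI HT. cbv zeta.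
  unfold row_prog. remember (CForM cell_prog) as cells eqn:Ec. cbn [den].
  pose proof (cells_spec env h j Hj E0 HI HT) as HC. cbv zeta in HC. rewrite <- Ec in HC.
  set (h1 := den n m cells 1 env h) in *. clearbody h1. destruct HC as (HS & HT1 & HC).
  cbn [evN evR nS eG cell_ix]. rewrite E0. change (1 + j) with (S j).
  rewrite Nat.add_0_r.
  change (setN (setR h1 2 (S j) (ra h1 1 (S j * m))) 1 (S j) 0)
    with (put h1 2 1 (S j) (ra h1 1 (S j * m)) 0).
  set (I := fun (k : nat) (h' : heap) => exists v a, h' = put h1 2 1 (S j) v a /\
    a < m /\ v = Gh h1 (S j) a /\ forall k', k' < k -> (v <= Gh h1 (S j) k')%R).
  match goal with |- context [iterate ?f m ?h1] => enough (HI' : I m (iterate f m h1));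
    [set (h2 := iterate f m h1) in *; clearbody h2|] end.
  { destruct HI' as (v & a & -> & Ha & Hv & Hmin).
    assert (HG : Gh (put h1 2 1 (S j) v a) = Gh h1).
    { unfold Gh. cbn [put na ra setR setN]. now rewrite upd2_array by lia. }
    assert (HP : Ph (put h1 2 1 (S j) v a) = Ph h1).
    { unfold Ph. cbn [put na ra setR setN]. now rewrite upd2_array by lia. }
    split; [eapply same_out_trans; [exact HS|apply same_out_put; lia]|].
    rewrite HG, HP.
    assert (HF : forall i, i <= j -> Fh (put h1 2 1 (S j) v a) i = Fh h1 i).
    { intros i Hi. cbn [put na ra setR setN]. apply upd2_other. right; lia. }
    assert (HT2 : dp_table t r B (Gh h1) (Fh (put h1 2 1 (S j) v a)) (Ph h1)
      (Ah (put h1 2 1 (S j) v a)) j).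
    { eapply dp_table_frame; [| |exact HF| |exact HT1]; auto.
      intros i Hi. cbn [put na ra setR setN]. apply upd2_other. right; lia. }
    destruct HT2 as (H0 & H1 & H2). split; [auto|]. split; [auto|].
    intros i Hi. destruct (Nat.eq_dec i j) as [->|]; [|apply H2; lia].
    split; [|split; [|split]].
    - intros k Hk. apply dp_cell_frame with (G := Gh h1) (F := Fh h1) (P := Ph h1); auto.
    - cbn [put na ra setR setN]. rewrite upd2_same. auto.
    - cbn [put na ra setR setN]. rewrite !upd2_same. auto.
    - intros k Hk. cbn [put na ra setR setN]. rewrite upd2_same. auto. }
  apply iterate_ind.
  (* Station 0 is the first candidate; it exists by [m_pos]. *)
  { exists (ra h1 1 (S j * m)), 0. repeat split; auto; [|intros; lia].
    unfold Gh. now rewrite Nat.add_0_r. }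
  intros k h2 Hk (v & a & -> & Ha & Hv & Hmin).
  rewrite den_improve. cbv zeta. cbn [evN evR nS eG cell_ix ext Nat.eqb]. rewrite E0.
  change (1 + j) with (S j).
  replace (ra (put h1 2 1 (S j) v a) 1 (S j * m + k)) with (Gh h1 (S j) k)
    by (unfold Gh; cbn [put na ra setR setN]; now rewrite upd2_array by lia).
  replace (Fh (put h1 2 1 (S j) v a) (S j)) with v
    by (cbn [put na ra setR setN]; now rewrite upd2_same).
  destruct Rlt_dec as [L|L].
  - exists (Gh h1 (S j) k), k. split; [apply put_put|]. repeat split; auto.
    intros k' Hk'. destruct (Nat.eq_dec k' k) as [->|]; [lra|].
    specialize (Hmin k' ltac:(lia)). lra.
  - exists v, a. repeat split; auto.
    intros k' Hk'. destruct (Nat.eq_dec k' k) as [->|]; [lra|]. apply Hmin; lia.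
Qed.

Lemma init_spec env h : ra h 0 = input -> Fh h 0 = 0%R ->
  let h' := den n m init_prog 0 env h in same_out h h' /\ table h' 0.
Proof.
  intros HI HF. cbv zeta. unfold init_prog. cbn [den evN evR eC ext Nat.eqb].
  match goal with |- context [iterate ?f m h] => enough (HJ :
    same_out h (iterate f m h) /\ Fh (iterate f m h) = Fh h /\
    forall k, k < m -> ra (iterate f m h) 1 k = sc B k) end.
  { destruct HJ as (H1 & H2 & H3). split; [auto|]. split; [exact H3|]. split.
    - rewrite H2. auto.
    - intros; lia. }
  apply iterate_ind with (I := fun k h' => same_out h h' /\ Fh h' = Fh h /\
    forall k', k' < k -> ra h' 1 k' = sc B k').
  { repeat split; auto. intros; lia. }
  intros k h1 Hk (H1 & H2 & H3). split; [|split].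
  - eapply same_out_trans; [exact H1|].
    repeat split; cbn [na ra setR]; now rewrite ?upd2_array by lia.
  - cbn [ra setR]. now rewrite upd2_array by lia.
  - intros k' Hk'. cbn [ra setR]. destruct (Nat.eq_dec k' k) as [->|].
    + rewrite upd2_same. destruct H1 as [-> _]. rewrite HI. apply input_c; auto.
    + rewrite upd2_other by lia. apply H3. lia.
Qed.

Lemma dp_spec env h : ra h 0 = input -> Fh h 0 = 0%R ->
  let h' := den n m (CSeq init_prog (CForN row_prog)) 0 env h in same_out h h' /\ table h' n.
Proof.
  intros HI HF. cbv zeta. destruct (init_spec env h HI HF) as [H1 H2].
  remember row_prog as row eqn:Er. cbn [den]. cbv zeta in H1, H2.
  set (h1 := den n m init_prog 0 env h) in *. clearbody h1.
  apply iterate_ind with (I := fun j h' => same_out h h' /\ table h' j); [auto|].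
  clear h1 H1 H2. intros j h1 Hj [H1 H2]. rewrite Er.
  destruct (row_spec (ext env 0 j) h1 j) as [H3 H4]; auto.
  { destruct H1 as (H10 & _). rewrite H10. exact HI. }
  split; [eapply same_out_trans; eauto|auto].
Qed.

(** * Backtracking in memory *)

Definition written (out : nat -> R) (o : nat -> bool) (L : list (nat * R)) : Prop :=
  (forall k, k < m -> out (1 + k) = if o k then 1%R else 0%R) /\
  forall l, l < length L ->
    out (1 + m + 2 * l) = INR (fst (nth l L (0, 0%R))) /\
    out (2 + m + 2 * l) = snd (nth l L (0, 0%R)).

Lemma written_emit out out' o L k x :
  written out o L ->
  out' (1 + m + 2 * length L) = INR k -> out' (2 + m + 2 * length L) = x ->
  (forall i, i < 1 + m + 2 * length L -> out' i = out i) ->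
  written out' o (L ++ [(k, x)]).
Proof.
  intros [H1 H2] Hk Hx Ho. split.
  - intros k' Hk'. rewrite Ho by lia. auto.
  - intros l Hl. rewrite length_app in Hl. simpl in Hl.
    destruct (Nat.eq_dec l (length L)) as [->|Hn].
    + rewrite nth_middle. auto.
    + rewrite app_nth1, !Ho by lia. apply H2. lia.
Qed.

Lemma written_open out out' o L k : k < m ->
  written out o L -> out' (1 + k) = 1%R -> (forall i, i <> 1 + k -> out' i = out i) ->
  written out' (with_station o k) L.
Proof.
  intros Hkm [H1 H2] Hk Ho. split.
  - intros k' Hk'. unfold with_station. destruct (Nat.eqb_spec k' k) as [->|]; auto.
    rewrite Ho by lia. auto.
  - intros l Hl. rewrite !Ho by lia. auto.
Qed.

Variable hd : heap.
Hypothesis hd_input : ra hd 0 = input.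
Hypothesis hd_out : ra hd 5 = fun _ => 0%R.
Hypothesis hd_len : na hd 5 0 = 0.
Hypothesis hd_table : table hd n.
Hypothesis t_sorted : forall i j, i <= j < n -> (t i <= t j)%R.
Hypothesis sc_nonneg : forall k, k < m -> (0 <= sc B k)%R.

Definition same_tables (h : heap) : Prop :=
  ra h 0 = input /\ ra h 1 = ra hd 1 /\ ra h 2 = ra hd 2 /\ na h 0 = na hd 0 /\ na h 1 = na hd 1.

(** [na h 2 0 + it <= n] forces the number of remaining targets to 0 after [n] rounds;
    [length L <= it] bounds the output size, which fixes how much has to be moved back. *)
Definition tracing (it : nat) (h : heap) : Prop :=
  same_tables h /\ exists o L,
    partial t r B (Gh hd) (Fh hd) n (na h 2 0) (na h 3 0) o L /\
    written (ra h 5) o L /\ na h 5 0 = length L /\ na h 2 0 + it <= n /\ length L <= it.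

Lemma emit_spec env h d o L j : same_tables h -> na h 3 0 < m -> na h 2 0 = S j ->
  written (ra h 5) o L -> na h 5 0 = length L ->
  let h' := den n m emit_prog d env h in
  same_tables h' /\ na h' 2 = na h 2 /\ na h' 3 = na h 3 /\ na h' 4 = na h 4 /\
  na h' 5 0 = S (length L) /\
  written (ra h' 5) o (L ++ [(na h 3 0, dest t r B (na h 3 0) (na h 4 0) j)]).
Proof.
  intros (E1 & E2 & E3 & E4 & E5) Hk Hj HW HL. cbv zeta.
  unfold emit_prog. remember (eDest vK vI (RLd 0 (NAdd (NC 2) vJ))) as e eqn:Ee.
  cbn [den evN evR vK vQ nS].
  set (h1 := setR h 5 _ _).
  assert (He : evR n m env h1 e = dest t r B (na h 3 0) (na h 4 0) j).
  { subst e. rewrite (evR_dest env h1 vK vI _ j).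
    - unfold h1. reflexivity.
    - unfold h1. cbn [ra setR]. now rewrite upd2_array by lia.
    - exact Hk.
    - unfold h1. cbn [evR evN vJ ra na setR]. rewrite upd2_array, E1, Hj by lia.
      reflexivity. }
  rewrite He. unfold h1. cbn [na ra setN setR]. rewrite HL.
  split; [|split; [|split; [|split; [|split]]]].
  - repeat split; cbn [na ra setN setR]; now rewrite ?upd2_array by lia.
  - now rewrite upd2_array by lia.
  - now rewrite upd2_array by lia.
  - now rewrite upd2_array by lia.
  - now rewrite upd2_same.
  - eapply written_emit; [exact HW| | |].
    + heap_simp. reflexivity.
    + heap_simp. reflexivity.
    + intros i Hi. heap_simp. reflexivity.
Qed.

Lemma switch_spec env h d o L ix : same_tables h -> na hd 1 (evN n m env h ix) < m ->
  written (ra h 5) o L ->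
  let h' := den n m (switch_prog ix) d env h in
  same_tables h' /\ na h' 2 = na h 2 /\ na h' 4 = na h 4 /\ na h' 5 = na h 5 /\
  na h' 3 0 = na hd 1 (evN n m env h ix) /\
  written (ra h' 5) (with_station o (na hd 1 (evN n m env h ix))) L.
Proof.
  intros (E1 & E2 & E3 & E4 & E5) Hk HW. cbv zeta.
  unfold switch_prog. cbn [den evN evR vK nS].
  cbn [na ra setN setR]. rewrite upd2_same, E5.
  split; [|split; [|split; [|split; [|split]]]].
  - repeat split; cbn [na ra setN setR]; now rewrite ?upd2_array by lia.
  - now rewrite upd2_array by lia.
  - now rewrite upd2_array by lia.
  - now rewrite upd2_array by lia.
  - reflexivity.
  - eapply written_open; [exact Hk|exact HW| |].
    + heap_simp. reflexivity.
    + intros i Hi. heap_simp. reflexivity.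
Qed.

Lemma step_spec env h d it : tracing it h -> 0 < na h 2 0 ->
  tracing (S it) (den n m trace_step d env h).
Proof.
  intros (HS & o & L & HP & HW & HL & Hit & HLi) Hpos.
  destruct (na h 2 0) as [|j] eqn:Ej; [lia|]. set (k := na h 3 0) in *.
  assert (Hk : k < m) by apply HP.
  (* [A] is known to name a station only where a change of station occurs, so the bound is extracted
     under that condition. *)
  assert (Hsw : (Fh hd (Ph hd (S j) k) + sc B k < Gh hd (Ph hd (S j) k) k)%R ->
    Ah hd (Ph hd (S j) k) < m).
  { intros Hlt. destruct (partial_step t r B (Gh hd) (Fh hd) (Ph hd) (Ah hd) n
      t_sorted sc_nonneg hd_table j k o L HP) as (_ & H & _). apply H; auto. }
  destruct (partial_step t r B (Gh hd) (Fh hd) (Ph hd) (Ah hd) n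
      t_sorted sc_nonneg hd_table j k o L HP) as (Hi & Hstep1 & Hstep2).
  set (i := Ph hd (S j) k) in *.
  unfold trace_step. remember emit_prog as ep eqn:Eep.
  remember (switch_prog vI) as sp eqn:Esp. cbn [den].
  set (h1 := setN h 4 _ _).
  assert (Hh1 : same_tables h1 /\ na h1 2 0 = S j /\ na h1 3 0 = k /\ na h1 4 0 = i).
  { unfold h1. destruct HS as (E1 & E2 & E3 & E4 & E5).
    split; [repeat split; cbn [na ra setN setR]; now rewrite ?upd2_array by lia|].
    cbn [na setN evN cell_ix vJ vK]. rewrite !(upd2_array _ 4) by lia. rewrite upd2_same.
    rewrite E4, Ej. auto. }
  destruct Hh1 as (HS1 & Hj1 & Hk1 & Hi1).
  destruct (emit_spec env h1 d o L j) as (HS2 & F2 & F3 & F4 & F5 & HW2); auto; try congruence.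
  rewrite <- Eep in *. set (h2 := den n m ep d env h1) in *. clearbody h2.
  rewrite Hk1, Hi1 in HW2. clearbody h1. clear Eep ep.
  assert (Hcond : evB n m env h2 (BRLt (eOpen vI vK) (eG vI vK)) =
    if Rlt_dec (Fh hd i + sc B k) (Gh hd i k) then true else false).
  { destruct HS2 as (E1 & E2 & E3 & E4 & E5).
    cbn [evB evR evN eOpen eG eC vI vK cell_ix]. rewrite E1, E2, E3, F3, F4, Hk1, Hi1.
    rewrite input_c by auto. reflexivity. }
  rewrite Hcond.
  assert (Hlen : length (L ++ [(k, dest t r B k i j)]) = S (length L))
    by (rewrite length_app; simpl; lia).
  destruct (Rlt_dec (Fh hd i + sc B k) (Gh hd i k)) as [Hlt|Hlt].
  - assert (Ei : evN n m env h2 vI = i) by (cbn [evN vI]; congruence).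
    destruct (switch_spec env h2 d o (L ++ [(k, dest t r B k i j)]) vI)
      as (HS3 & K2 & K4 & K5 & K3 & HW3); auto.
    { rewrite Ei. auto. }
    rewrite <- Esp in *. set (h3 := den n m sp d env h2) in *. clearbody h3.
    rewrite Ei in *. cbn [evN vI].
    assert (Hi3 : na h3 4 0 = i) by congruence. rewrite Hi3.
    split.
    { destruct HS3 as (E1 & E2 & E3 & E4 & E5).
      repeat split; cbn [na ra setN setR]; now rewrite ?upd2_array by lia. }
    exists (with_station o (Ah hd i)), (L ++ [(k, dest t r B k i j)]).
    cbn [na ra setN]. rewrite upd2_same, !(upd2_array _ 2) by lia. rewrite K3, K5, F5, Hlen.
    repeat split; try apply HW3; try apply Hstep1; auto; lia.
  - cbn [evN vI]. rewrite F4, Hi1.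
    split.
    { destruct HS2 as (E1 & E2 & E3 & E4 & E5).
      repeat split; cbn [na ra setN setR]; now rewrite ?upd2_array by lia. }
    exists o, (L ++ [(k, dest t r B k i j)]).
    cbn [na ra setN]. rewrite upd2_same, !(upd2_array _ 2) by lia. rewrite F3, Hk1, F5, Hlen.
    repeat split; try apply HW2; try apply Hstep2; auto; lia.
Qed.

Variable T : list R.
Hypothesis T_in_t : forall x, In x T -> exists i, i < n /\ t i = x.
Hypothesis t_in_T : forall i, i < n -> In (t i) T.

Lemma trace_spec env : exists S : solution,
  encodes (ra (den n m trace_prog 0 env hd) 5) m S /\ length (sensors S) <= n /\
  optimal T B r S.
Proof.
  assert (Hfin : forall h o L, written (ra h 5) o L -> na h 5 0 = length L ->
    encodes (ra (den n m (CSetR 5 (NC 0) (ROfN vQ)) 0 env h) 5) m (mkSol (map o (seq 0 m)) L)).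
  { intros h o L [H1 H2] HL. cbn [den evN evR vQ ra setR]. rewrite HL.
    split; [cbn [opened]; now rewrite length_map, length_seq|].
    cbn [opened sensors]. split; [|split].
    - intros k Hk. rewrite upd2_other by lia. pose proof (nth_map_seq B o k Hk) as E. fold m in E. rewrite E. apply H1; auto.
    - apply upd2_same.
    - intros l Hl. rewrite !upd2_other by lia. apply H2; auto. }
  unfold trace_prog. remember (CSetR 5 (NC 0) (ROfN vQ)) as fin eqn:Ef.
  remember trace_step as ts eqn:Et. remember (switch_prog NN) as sp eqn:Es.
  cbn [den evB evN]. destruct (Nat.ltb_spec 0 n) as [Hn|Hn].
  - set (h1 := setN hd 2 0 n).
    assert (HS1 : same_tables h1).
    { unfold h1. repeat split; cbn [na ra setN setR]; now rewrite ?upd2_array by lia. }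
    pose proof (partial_init t r B (Gh hd) (Fh hd) (Ph hd) (Ah hd) n sc_nonneg hd_table Hn) as HP.
    destruct (switch_spec env h1 0 (fun _ => false) [] NN) as (HS2 & K2 & _ & K5 & K3 & HW); auto.
    { apply HP. }
    { unfold h1. split; [|simpl; intros; lia]. intros k _. cbn [ra setN]. now rewrite hd_out. }
    rewrite <- Es in *. set (h2 := den n m sp 0 env h1) in *. clearbody h2.
    cbn [evN] in K3, HW.
    assert (HT : tracing 0 h2).
    { split; [auto|]. exists (with_station (fun _ => false) (Ah hd n)), [].
      assert (E2 : na h2 2 0 = n) by (rewrite K2; reflexivity).
      rewrite K5, K3, E2. repeat split; try apply HP; try apply HW; auto; try lia. }
    match goal with |- context [iterate ?f n h2] =>
      assert (HTn : tracing n (iterate f n h2)); [|set (h3 := iterate f n h2) in *] end.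
    { apply iterate_ind; [exact HT|]. intros it h Hit Hh.
      destruct (Nat.ltb_spec 0 (evN n m (ext env 0 it) h vJ)) as [L|L];
        cbn [evN vJ] in L.
      - rewrite Et. apply step_spec; auto.
      - destruct Hh as (A1 & o & L0 & A2 & A3 & A4 & A5 & A6).
        split; [auto|]. exists o, L0. repeat split; try apply A2; try apply A3; auto; lia. }
    destruct HTn as (_ & o & L & HPn & HWn & HLn & Hjn & HlL).
    exists (mkSol (map o (seq 0 m)) L). split; [apply Hfin; auto|]. split; [exact HlL|].
    replace (na h3 2 0) with 0 in HPn by lia.
    eapply partial_optimal; eauto.
  - exists (mkSol (map (fun _ => false) (seq 0 m)) []).
    split; [apply Hfin; [split|]|split].
    + intros k _. now rewrite hd_out.
    + simpl; intros; lia.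
    + auto.
    + simpl; lia.
    + eapply optimal_intro; eauto.
      * contradiction.
      * intros; lia.
      * rewrite psum_nil. destruct hd_table as (_ & H0 & _).
        replace n with 0 by lia. rewrite H0.
        assert (E : forall q, csum (sc B) (fun _ => false) q = 0%R)
          by (intros q; induction q; simpl; [auto|lra]).
        rewrite E. lra.
Qed.

End Dynamic.

(** * Relocation of input and output *)

Section Relocation.
Local Open Scope nat_scope.

(** Repetition by program text: it serves where no register is free for a counter, or where the
    register operated on changes from round to round. *)
Fixpoint unroll (f : nat -> prog) (k : nat) : prog :=
  match k with O => PSkip | S k' => PSeq (unroll f k') (f k') end.

Lemma runs_unroll (I : nat -> mem -> Prop) f k s c :
  I 0 s -> (forall i s1, i < k -> I i s1 -> runs (f i) s1 (I (S i)) c) ->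
  runs (unroll f k) s (I k) (k * c).
Proof.
  intros H0 HS. induction k as [|k IH]; cbn [unroll].
  - eapply runs_weaken; [apply runs_skip; exact H0|auto|lia].
  - eapply runs_seq.
    + eapply runs_weaken; [apply IH; intros; apply HS; auto| |apply Nat.le_refl].
      intros s1 H1. apply HS; auto.
    + lia.
Qed.

Fixpoint seqs (l : list prog) (q : prog) : prog :=
  match l with [] => q | p :: l' => PSeq p (seqs l' q) end.

Definition mfactor := 64.
(** Chosen so that [2 * (n + mfactor * m)], the first address the prologue can form, is cell 2 of
    real array 0, the place of [r]. The factor 64 makes the heap start beyond input, output and
    registers already for [m = 1]; the doubling makes room for the [2 * n] output cells. *)
Definition base_of (n m : nat) := 2 * n + 2 * mfactor * m - 2 * stride.

(* Only the cells holding n, m and r can be touched first: n is overwritten by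
   the recoverable value n + 64 m, doubled, which addresses free memory since m >= 1. *)
Definition prologue : prog :=
  PSeq (unroll (fun _ => PBin OAdd 0 0 1) mfactor)
  (seqs [PBin OAdd 0 0 0; PStore 0 2; PConst 2 (Z.of_nat stride)]
  (PSeq (unroll (fun x => PSeq (PBin OAdd 0 0 2) (PStore 0 (3 + x))) (nregs - 3))
  (seqs [PConst 3 (Z.of_nat ((nregs - 1) * stride)); PBin OSub 0 0 3;
         PConst 3 0; PBin OAdd 2 1 3;
         PConst 4 (Z.of_nat mfactor); PBin OMul 4 4 2; PConst 5 (Z.of_nat stride);
         PConst 6 2; PBin ODiv 1 0 6; PBin OAdd 1 1 5; PBin OSub 1 1 4;
         PConst 3 1; PConst 5 (Z.of_nat (nregs + 3)); PBin OAdd 5 5 1;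
         PBin OAdd 5 5 2; PBin OAdd 5 5 2; PBin OAdd 5 5 2;
         PConst 6 (Z.of_nat (nregs * stride)); PBin OAdd 6 6 0;
         PConst 7 (Z.of_nat stride); PConst 4 (Z.of_nat nregs)]
  (PWhile CLt 4 5
    (seqs [PLoad 8 4; PStore 6 8; PBin OAdd 4 4 3] (PBin OAdd 6 6 7)))))).

(** Output cells beyond the registers are copied by a loop. For the registers themselves, each is
    first filled with the address of its own output cell and then replaced by the contents with
    [PLoad x x], which takes no further register. *)
Definition epilogue (oa : nat) : prog :=
  seqs [PConst 5 (Z.of_nat (nregs + 1)); PBin OAdd 5 5 1; PBin OAdd 5 5 1; PBin OAdd 5 5 2;
        PConst 6 (Z.of_nat (nregs * stride + 2 * oa)); PBin OAdd 6 6 0;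
        PConst 7 (Z.of_nat stride); PConst 4 (Z.of_nat nregs)]
  (PSeq (PWhile CLt 4 5
    (seqs [PLoad 8 6; PStore 4 8; PBin OAdd 4 4 3] (PBin OAdd 6 6 7)))
  (seqs [PConst 1 (Z.of_nat (2 * oa)); PBin OAdd 0 0 1]
  (PSeq (unroll (fun x => PSeq (PConst (S x) (Z.of_nat (stride * S x))) (PBin OAdd (S x) (S x) 0)) (nregs - 1))
        (unroll (fun x => PLoad x x) nregs)))).

Lemma runs_div d a b s (Q : mem -> Prop) : s b <> 0%R ->
  Q (upd s d (s a / s b)%R) -> runs (PBin ODiv d a b) s Q 1.
Proof. intros H0 H. do 2 eexists; split; [constructor; split; auto | auto]. Qed.

Ltac seq1 := eapply runs_seq with (c1 := 1); [|apply Nat.le_refl].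

Section Input.

Variables (n m : nat) (f : mem).
Hypothesis m_pos : 1 <= m.
Let base := base_of n m.
Hypothesis f_n : f 0 = INR n.
Hypothesis f_m : f 1 = INR m.
Hypothesis f_end : forall x, 3 + n + 3 * m <= x -> f x = 0%R.

(** The heap starts above both the input and the output area, so neither copying loop overwrites a
    cell that it has still to read. *)
Lemma base_of_ge : nregs + 3 + n + 3 * m <= base /\ nregs + 1 + m + 2 * n <= base.
Proof. unfold base, base_of, nregs, mfactor, stride. lia. Qed.

Lemma base_of_eq : base + 2 * stride = 2 * (n + mfactor * m).
Proof. unfold base, base_of, nregs, mfactor, stride. lia. Qed.

(** Copying starts at cell 2 because [n] and [m] are kept in registers. That the rest of the heap is
    zero supplies [F 0 = 0], the closed flags and the sensor counter. *)
Definition copied (i : nat) (s : mem) : Prop :=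
  (forall x, nregs <= x < base -> s x = f x) /\
  (forall j, 2 <= j < i -> s (base + stride * j) = f j) /\
  (forall x, base <= x -> (forall j, 2 <= j < i -> x <> base + stride * j) -> s x = 0%R).

Lemma copied_upd_reg i s a v : a < nregs -> copied i s -> copied i (upd s a v).
Proof.
  intros Ha (H1 & H2 & H3). pose proof base_of_ge.
  repeat split; intros; rewrite upd_other by lia; auto.
Qed.

Lemma copied_step i s : 2 <= i -> copied i s -> copied (S i) (upd s (base + stride * i) (f i)).
Proof.
  intros Hi (H1 & H2 & H3). pose proof base_of_ge. unfold copied, stride in *. repeat split.
  - intros. rewrite upd_other by lia. auto.
  - intros j Hj. destruct (Nat.eq_dec j i) as [->|].
    + apply upd_same.
    + rewrite upd_other by (lia). apply H2. lia.
  - intros x Hx Hj. rewrite upd_other by (apply Hj; lia). apply H3; auto.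
    intros; apply Hj; lia.
Qed.

Definition input_heap : heap :=
  mkHeap (fun _ _ => 0)
    (fun a i => if (a =? 0) && (2 <=? i) && (i <? nregs + 3 + n + 3 * m) then f i else 0%R).

Lemma copied_rep env s :
  copied (nregs + 3 + n + 3 * m) s ->
  s 0 = INR base -> s 1 = INR n -> s 2 = INR m -> s 3 = 1%R ->
  rep n m base 0 env input_heap s.
Proof.
  intros (H1 & H2 & H3) E0 E1 E2 E3. repeat split; auto; try lia.
  - cbn [ra input_heap].
    destruct (Nat.eqb_spec a 0); [destruct (Nat.leb_spec 2 i);
      [destruct (Nat.ltb_spec i (nregs + 3 + n + 3 * m))|]|]; cbn [andb];
      unfold stride, narr in *.
    + subst. rewrite Nat.add_0_r. apply H2. lia.
    + apply H3; [lia|]. intros. lia.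
    + apply H3; [lia|]. intros. lia.
    + apply H3; [lia|]. intros. lia.
  - cbn [na input_heap]. unfold stride, narr in *. apply H3; [lia|]. intros. lia.
Qed.

Lemma runs_prologue env : exists c,
  runs prologue f (rep n m base 0 env input_heap) c /\ c <= 800 + 5 * (n + 3 * m).
Proof.
  pose proof base_of_ge as HB. pose proof base_of_eq as HE.
  eexists. split.
  { unfold prologue.
  eapply runs_seq; [|apply Nat.le_refl].
  eapply runs_weaken; [apply runs_unroll with (c := 1) (I := fun i s =>
    s 0 = INR (n + i * m) /\ forall x, x <> 0 -> s x = f x)| |apply Nat.le_refl].
  { split; auto. rewrite f_n. f_equal. lia. }
  { intros i s1 _ [A1 A2]. apply runs_add. split.
    - rewrite upd_same, A1, A2, f_m by lia. rewrite <- plus_INR. f_equal. lia.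
    - intros x Hx. rewrite upd_other by lia. auto. }
  intros s1 [A1 A2]. cbn [seqs].
  seq1. apply runs_add.
  seq1. apply runs_store with (k := base + stride * 2).
  { rewrite upd_same, A1, <- plus_INR. f_equal. lia. }
  seq1. apply runs_const.
  rewrite (upd_other _ 0 _ 2), (A2 2) by lia.
  eapply runs_seq; [|apply Nat.le_refl].
  (* With [r] saved, cell 2 is free to hold [stride]. Stepping cell 0 by it moves the cells from 3
     to [nregs - 1] to the heap and so frees them. *)
  eapply runs_weaken; [apply runs_unroll with (c := 2) (I := fun i s =>
    s 0 = INR (base + stride * (2 + i)) /\ s 1 = INR m /\ s 2 = INR stride /\
    (forall x, 3 + i <= x < nregs -> s x = f x) /\ copied (3 + i) s)| |apply Nat.le_refl].
  { repeat split; intros; unfold nregs, stride in *; mem_simp.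
    - rewrite A1, <- plus_INR. f_equal. lia.
    - rewrite A2; auto.
    - now rewrite <- INR_IZR_INZ.
    - apply A2; lia.
    - destruct (Nat.eq_dec x (base + 16 * 2)); [lia|]. mem_simp. apply A2; lia.
    - replace j with 2 by lia. mem_simp. auto.
    - assert (x <> base + 16 * 2) by (apply H0; lia). mem_simp. rewrite A2 by lia. apply f_end; lia. }
  { intros i s2 Hi (B0 & B1 & B2 & B3 & B4).
    seq1. apply runs_add. eapply runs_store with (k := base + stride * (3 + i)).
    { rewrite upd_same, B0, B2, <- plus_INR. f_equal. lia. }
    rewrite (upd_other _ 0 _ (3 + i)) by lia. rewrite (B3 (3 + i)) by lia.
    unfold nregs in *.
    repeat split; intros.
    - mem_simp. rewrite B0, B2, <- plus_INR. f_equal. lia.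
    - mem_simp. auto.
    - mem_simp. auto.
    - mem_simp. apply B3; lia.
    - apply copied_step; [lia|apply copied_upd_reg; auto; unfold nregs; lia|auto].
    - apply copied_step; [lia|apply copied_upd_reg; auto; unfold nregs; lia|auto].
    - apply copied_step; [lia|apply copied_upd_reg; auto; unfold nregs; lia|auto|auto]. }
  intros s2 (B0 & B1 & B2 & _ & B4).
  do 8 (seq1; first [apply runs_const|apply runs_add|apply runs_sub|apply runs_mul]; mem_simp).
  seq1. apply runs_div. { mem_simp. lra. } mem_simp.
  do 12 (seq1; first [apply runs_const|apply runs_add|apply runs_sub|apply runs_mul]; mem_simp).
  (* This bound is at least [nregs] and lies past the input in every case; the surplus cells copied
     are zero. *)
  set (N := nregs + 3 + n + 3 * m).
  apply runs_count with (i := nregs) (N := N) (c := 4) (I := fun i s =>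
    s 0 = INR base /\ s 1 = INR n /\ s 2 = INR m /\ s 3 = 1%R /\ s 4 = INR i /\ s 5 = INR N /\
    s 6 = INR (base + stride * i) /\ s 7 = INR stride /\ copied i s).
  { unfold N; lia. }
  { assert (E0 : Rminus (s2 0) (IZR (Z.of_nat ((nregs - 1) * stride))) = INR base).
    { rewrite B0, <- INR_IZR_INZ, <- minus_INR by (unfold nregs, stride; lia). f_equal.
      unfold nregs, stride; lia. }
    (* [n] is recovered from the address: [base / 2 = n + mfactor * m - stride]. *)
    assert (E1 : (INR base / 2 + IZR (Z.of_nat stride) - IZR (Z.of_nat mfactor) * INR m)%R = INR n).
    { apply (f_equal INR) in HE. rewrite plus_INR, !mult_INR, plus_INR, mult_INR in HE.
      rewrite <- !INR_IZR_INZ. simpl (INR 2) in HE. lra. }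
    assert (copied nregs s2) as HC by exact B4. unfold copied in HC.
    unfold N.
    repeat split; mem_simp; rewrite ?E0, ?B1, ?Rplus_0_r; auto.
    - now rewrite <- INR_IZR_INZ.
    - rewrite E1, <- INR_IZR_INZ, <- !plus_INR. f_equal. lia.
    - rewrite <- INR_IZR_INZ, <- !plus_INR. f_equal. lia.
    - now rewrite <- INR_IZR_INZ.
    - intros. unfold nregs in *. mem_simp. apply HC; lia.
    - intros. unfold nregs in *. mem_simp. apply HC; lia.
    - intros. unfold nregs in *. mem_simp. apply HC; auto; lia. }
  { intros j s3 Hj H. split; apply H. }
  { intros i s3 Hi (C0 & C1 & C2 & C3 & C4 & C5 & C6 & C7 & C8).
    eapply runs_seq with (c1 := 1) (c2 := 3); [|lia].
    eapply runs_load; [exact C4|].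
    eapply runs_seq with (c1 := 1) (c2 := 2); [|lia].
    eapply runs_store with (k := base + stride * i). { mem_simp. auto. }
    mem_simp. replace (s3 i) with (f i) by (symmetry; apply C8; unfold N in *; lia).
    eapply runs_seq with (c1 := 1) (c2 := 1); [|lia]. apply runs_add. apply runs_add.
    assert (copied (S i) (upd (upd s3 8 (f i)) (base + stride * i) (f i))) as HC
      by (apply copied_step; [unfold nregs in *; lia|apply copied_upd_reg; auto; unfold nregs; lia]).
    unfold nregs in *.
    split; [mem_simp; auto|]. split; [mem_simp; auto|]. split; [mem_simp; auto|].
    split; [mem_simp; auto|]. split; [mem_simp; rewrite C4, C3, S_INR; auto|].
    split; [mem_simp; auto|].
    split; [mem_simp; rewrite C6, C7, <- plus_INR; f_equal; lia|].
    split; [mem_simp; auto|].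
    apply copied_upd_reg; [unfold nregs; lia|]. apply copied_upd_reg; [unfold nregs; lia|auto]. }
  intros s3 (C0 & C1 & C2 & C3 & C4 & C5 & C6 & C7 & C8). apply copied_rep; auto. }
  unfold mfactor, nregs. lia.
Qed.

Lemma runs_epilogue oa env h s : oa < narr ->
  rep n m base 0 env h s ->
  runs (epilogue oa) s (fun s' => forall x, x < nregs + 1 + m + 2 * n -> s' x = ra h oa x)
    (200 + 5 * (m + 2 * n)).
Proof.
  intros Ha (H0 & H1 & H2 & H3 & _ & H5). pose proof base_of_ge as HB.
  assert (Hra : forall i, s (base + stride * i + 2 * oa) = ra h oa i) by (intros; apply H5; auto).
  clear H5. eapply runs_weaken; [|intros s1 Hs1; exact Hs1|].
  { unfold epilogue. cbn [seqs].
  do 8 (seq1; first [apply runs_const|apply runs_add|apply runs_sub|apply runs_mul]; mem_simp).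
  set (N := nregs + 1 + m + 2 * n) in *.
  eapply runs_seq; [|apply Nat.le_refl].
  eapply runs_weaken;
    [apply runs_count with (i := nregs) (N := N) (c := 4) (I := fun i s' =>
      s' 0 = INR base /\ s' 3 = 1%R /\ s' 4 = INR i /\ s' 5 = INR N /\
      s' 6 = INR (base + stride * i + 2 * oa) /\ s' 7 = INR stride /\
      (forall x, base <= x -> s' x = s x) /\
      (forall x, nregs <= x < i -> s' x = ra h oa x))
      (Q := fun s' => s' 0 = INR base /\ (forall x, base <= x -> s' x = s x) /\
      (forall x, nregs <= x < N -> s' x = ra h oa x))| |apply Nat.le_refl].
  { unfold N; lia. }
  { unfold nregs in *. repeat split; intros; mem_simp; auto; try lia.
    - now rewrite <- INR_IZR_INZ.
    - rewrite H1, H2, <- INR_IZR_INZ, <- !plus_INR. f_equal. unfold N. lia.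
    - rewrite H0, <- INR_IZR_INZ, <- !plus_INR. f_equal. unfold stride; lia.
    - now rewrite <- INR_IZR_INZ. }
  { intros j s3 Hj H. split; apply H. }
  { intros i s3 Hi (C0 & C3 & C4 & C5 & C6 & C7 & C8 & C9).
    eapply runs_seq with (c1 := 1) (c2 := 3); [|lia].
    eapply runs_load; [exact C6|].
    eapply runs_seq with (c1 := 1) (c2 := 2); [|lia].
    eapply runs_store with (k := i). { mem_simp. auto. }
    mem_simp. rewrite C8, Hra by lia.
    eapply runs_seq with (c1 := 1) (c2 := 1); [|lia]. apply runs_add. apply runs_add.
    unfold nregs in *. repeat split; intros; mem_simp; auto.
    - rewrite C4, C3, S_INR; auto.
    - rewrite C6, C7, <- plus_INR. f_equal. unfold stride; lia.
    - destruct (Nat.eq_dec x i) as [->|]; mem_simp; auto. apply C9; lia. }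
  { intros s1 H. repeat split; apply H. }
  intros s1 (D0 & D1 & D2).
  do 2 (seq1; first [apply runs_const|apply runs_add|apply runs_sub|apply runs_mul]; mem_simp).
  eapply runs_seq; [|apply Nat.le_refl].
  eapply runs_weaken; [apply runs_unroll with (c := 2) (I := fun i s' =>
    (forall x, x < S i -> s' x = INR (base + stride * x + 2 * oa)) /\
    (forall x, base <= x -> s' x = s x) /\
    (forall x, nregs <= x < N -> s' x = ra h oa x))| |apply Nat.le_refl].
  { unfold nregs in *. repeat split; intros.
    - replace x with 0 by lia. mem_simp. rewrite D0, <- INR_IZR_INZ, <- plus_INR. f_equal. lia.
    - mem_simp. auto.
    - mem_simp. auto. }
  { intros i s2 Hi (E0 & E1 & E2). seq1. apply runs_const. apply runs_add.
    unfold nregs in *. repeat split; intros.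
    - destruct (Nat.eq_dec x (S i)) as [->|]; mem_simp; [|apply E0; lia].
      rewrite E0 by lia. rewrite <- INR_IZR_INZ, <- plus_INR. f_equal. lia.
    - mem_simp. auto.
    - mem_simp. auto. }
  intros s2 (E0 & E1 & E2).
  eapply runs_weaken; [apply runs_unroll with (c := 1) (I := fun i s' =>
    (forall x, x < i -> s' x = ra h oa x) /\
    (forall x, i <= x < nregs -> s' x = INR (base + stride * x + 2 * oa)) /\
    (forall x, base <= x -> s' x = s x) /\
    (forall x, nregs <= x < N -> s' x = ra h oa x))| |apply Nat.le_refl].
  { split; [lia|]. split; [intros; apply E0; unfold nregs in *; lia|auto]. }
  { intros i s3 Hi (F0 & F1 & F2 & F3).
    apply runs_load with (k := base + stride * i + 2 * oa); [apply F1; lia|].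
    unfold nregs in *. repeat split; intros.
    - destruct (Nat.eq_dec x i) as [->|]; mem_simp; [rewrite F2 by lia; apply Hra|apply F0; lia].
    - mem_simp. apply F1; lia.
    - mem_simp. auto.
    - mem_simp. auto. }
  intros s3 (F0 & F1 & F2 & F3). cbn beta. intros x Hx.
  destruct (Nat.lt_ge_cases x nregs); auto. }
  unfold nregs. lia.
Qed.

End Input.
End Relocation.

(** * The program on an instance *)

Section Instance.
Local Open Scope nat_scope.

Variables (T : list R) (B : list station) (r : R).
Let n := length T.
Let m := length B.
Let f := init_mem T B r.

Lemma init_mem_target i : i < n -> f (3 + i) = nth i T 0%R.
Proof.
  intros Hi. unfold f, init_mem. fold n m. cbn [Nat.eqb Nat.add].
  replace (S (S (S i)) <? S (S (S n))) with true by (symmetry; apply Nat.ltb_lt; lia).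
  f_equal. lia.
Qed.

Lemma init_mem_station k d : k < m -> d < 3 ->
  f (3 + d + n + 3 * k) =
  let b := nth k B default_station in
  match d with 0 => st_x b | 1 => st_y b | _ => st_cost b end.
Proof.
  intros Hk Hd. unfold f, init_mem. fold n m.
  assert (E1 : ((3 + d + n + 3 * k - 3 - n) mod 3) = d).
  { replace (3 + d + n + 3 * k - 3 - n) with (d + k * 3) by lia.
    rewrite Nat.Div0.mod_add. apply Nat.mod_small; auto. }
  assert (E2 : ((3 + d + n + 3 * k - 3 - n) / 3) = k).
  { replace (3 + d + n + 3 * k - 3 - n) with (d + k * 3) by lia.
    rewrite Nat.div_add, Nat.div_small by lia. lia. }
  rewrite E1, E2.
  destruct (Nat.eqb_spec (3 + d + n + 3 * k) 0); [lia|].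
  destruct (Nat.eqb_spec (3 + d + n + 3 * k) 1); [lia|].
  destruct (Nat.eqb_spec (3 + d + n + 3 * k) 2); [lia|].
  destruct (Nat.ltb_spec (3 + d + n + 3 * k) (3 + n)); [lia|].
  destruct (Nat.ltb_spec (3 + d + n + 3 * k) (3 + n + 3 * m)); [|lia].
  reflexivity.
Qed.

Lemma init_mem_end x : 3 + n + 3 * m <= x -> f x = 0%R.
Proof.
  intros Hx. unfold f, init_mem. fold n m.
  destruct (Nat.eqb_spec x 0); [lia|]. destruct (Nat.eqb_spec x 1); [lia|].
  destruct (Nat.eqb_spec x 2); [lia|]. destruct (Nat.ltb_spec x (3 + n)); [lia|].
  destruct (Nat.ltb_spec x (3 + n + 3 * m)); [lia|]. reflexivity.
Qed.

Hypothesis m_pos : 1 <= m.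
Hypothesis r_nonneg : (0 <= r)%R.
Hypothesis cost_nonneg : forall b, In b B -> (0 <= st_cost b)%R.

Let h0 := input_heap n m f.

Lemma input_heap_ra i : 2 <= i -> i < nregs + 3 + n + 3 * m -> ra h0 0 i = f i.
Proof.
  intros H1 H2. cbn [ra h0 input_heap].
  destruct (Nat.leb_spec 2 i); [|lia].
  destruct (Nat.ltb_spec i (nregs + 3 + n + 3 * m)); [|lia]. reflexivity.
Qed.

Lemma main_spec env : exists S : solution,
  encodes (ra (den n m main_prog 0 env h0) 5) m S /\ length (sensors S) <= n /\
  optimal T B r S.
Proof.
  destruct (sort_spec n m h0 env) as [(H1 & H2 & H3 & H4) HS].
  change (den n m main_prog 0 env h0) with
    (den n m trace_prog 0 env (den n m (CSeq init_prog (CForN row_prog)) 0 env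
      (den n m sort_prog 0 env h0))).
  set (h1 := den n m sort_prog 0 env h0) in *. clearbody h1.
  assert (Hr : ra h1 0 2 = r).
  { rewrite H1, input_heap_ra by (unfold nregs; lia). reflexivity. }
  assert (Hst : forall k d, k < m -> d < 3 ->
    ra h1 0 (3 + d + n + 3 * k) = f (3 + d + n + 3 * k)).
  { intros k d Hk Hd. rewrite H1, input_heap_ra by (unfold nregs; lia). reflexivity. }
  assert (Hx : forall k, k < m -> ra h1 0 (3 + n + 3 * k) = sx B k).
  { intros k Hk. etransitivity; [apply (Hst k 0); lia|apply (init_mem_station k 0); lia]. }
  assert (Hy : forall k, k < m -> ra h1 0 (4 + n + 3 * k) = sy B k).
  { intros k Hk. etransitivity; [apply (Hst k 1); lia|apply (init_mem_station k 1); lia]. }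
  assert (Hc : forall k, k < m -> ra h1 0 (5 + n + 3 * k) = sc B k).
  { intros k Hk. etransitivity; [apply (Hst k 2); lia|apply (init_mem_station k 2); lia]. }
  assert (Hcn : forall k, k < m -> (0 <= sc B k)%R).
  { intros k Hk. apply cost_nonneg, nth_In. auto. }
  (* The abstract [input] is instantiated with the array after sorting. *)
  destruct (dp_spec n r B (ra h1 0) m_pos r_nonneg Hr Hx Hy Hc env h1) as [(D1 & D2 & D3) HT]; auto.
  { rewrite H2 by lia. reflexivity. }
  fold m in D1, D2, D3, HT.
  set (h2 := den n m (CSeq init_prog (CForN row_prog)) 0 env h1) in *. clearbody h2.
  eapply (trace_spec n r B (ra h1 0)); eauto.
  - rewrite D2, H2 by lia. reflexivity.
  - rewrite D3, H3. reflexivity.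
  - intros i j Hij. destruct (Nat.eq_dec i j) as [->|]; [lra|]. apply HS. lia.
  - intros x Hin. apply In_nth with (d := 0%R) in Hin as (i & Hi & <-).
    apply (proj2 (H4 _)). exists i. split; [auto|]. unfold target.
    rewrite input_heap_ra, init_mem_target by (fold n in Hi; lia). reflexivity.
  - intros i Hi. destruct (proj1 (H4 (target h1 i))) as (i' & Hi' & E); [exists i; auto|].
    change (In (target h1 i) T). rewrite <- E. unfold target.
    rewrite input_heap_ra, init_mem_target by lia. apply nth_In. auto.
Qed.

Definition whole : prog := PSeq prologue (PSeq (compile main_prog 0) (epilogue 5)).

(** The 1030 absorbs prologue and epilogue, together at most [1000 + 15 * n + 20 * m] steps, through
    [n + m + 1 <= (n + 1) ^ 4 * (m + 1)]. *)
Lemma whole_spec : exists s' k S,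
  exec whole f s' k /\ k <= (1030 + weight main_prog) * ((n + 1) ^ 4 * (m + 1)) /\
  encodes s' m S /\ optimal T B r S.
Proof.
  pose (env := fun _ : nat => 0).
  destruct (main_spec env) as (S & HE & HL & HO).
  assert (f0 : f 0 = INR n) by reflexivity. assert (f1 : f 1 = INR m) by reflexivity.
  destruct (runs_prologue n m f m_pos f0 f1 init_mem_end env) as (c & Hpro & Hc).
  pose proof (base_of_ge n m m_pos) as Hb.
  assert (HR : runs whole f
    (fun s' => forall x, x < nregs + 1 + m + 2 * n -> s' x = ra (den n m main_prog 0 env h0) 5 x)
    (c + (tC n m main_prog + (200 + 5 * (m + 2 * n))))).
  { eapply runs_seq; [eapply runs_weaken; [exact Hpro| |apply Nat.le_refl]|apply Nat.le_refl].
    intros s1 Hs1. eapply runs_seq; [eapply runs_weaken|apply Nat.le_refl].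
    - apply runs_compile with (base := base_of n m) (env := env) (h := h0);
        [lia|exact Hs1|exact main_wf|lia].
    - intros s2 Hs2. eapply runs_epilogue; eauto. unfold narr; lia.
    - apply Nat.le_refl. }
  destruct HR as (s' & k & Hex & Hk & Hout). exists s', k, S.
  split; [exact Hex|]. split; [|split; [|exact HO]].
  - pose proof (tC_le n m main_prog 4 1 main_fits) as Ht.
    rewrite Nat.pow_1_r in Ht.
    set (X := (n + 1) ^ 4 * (m + 1)) in *.
    assert (n + m + 1 <= X).
    { unfold X. assert (1 <= (n + 1) ^ 3) by (pose proof (Nat.pow_nonzero (n + 1) 3); lia).
      rewrite Nat.pow_succ_r'. nia. }
    rewrite Nat.mul_add_distr_r. lia.
  - destruct HE as (E1 & E2 & E3 & E4). split; [exact E1|].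
    unfold nregs in Hout. split; [|split].
    + intros i Hi. rewrite Hout by lia. auto.
    + rewrite Hout by lia. auto.
    + intros j Hj. rewrite !Hout by lia. auto.
Qed.

End Instance.

(* There is a real-RAM program P and a constant C such that on every instance
   (n = length T targets, m = length B >= 1 base stations, r >= 0, costs >= 0)
   P halts within C * (n+1)^4 * (m+1) steps (= O(n^4 m) for n, m >= 1) and
   outputs an optimal solution. *)
Theorem theorem1 :
  exists (P : prog) (C : nat),
    forall (T : list R) (B : list station) (r : R),
      (1 <= length B)%nat ->
      0 <= r ->
      (forall b, In b B -> 0 <= st_cost b) ->
      exists (s' : mem) (k : nat) (S : solution),
        exec P (init_mem T B r) s' k /\
        (k <= C * ((length T + 1) ^ 4 * (length B + 1)))%nat /\
        encodes s' (length B) S /\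
        optimal T B r S.
Proof.
  exists whole, (1030 + weight main_prog)%nat. intros T B r. apply whole_spec.
Qed.
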